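(* Let $P(z)$ be a probability generating function that is analytic in a neighborhood of $z=1$ and satisfies $P(0)=0$ and $0<P'(0)<1$. Then its critical angle satisfies $\vartheta>\pi/2$.
   Context: A probability generating function is $P(z)=\sum_{n\ge0}p_nz^n$ with all $p_n\ge0$ and $\sum p_n=1$. $P^{\circ t}$ denotes the $t$-fold composition. $P$ is regarded as a holomorphic function on a fixed domain (connected open set) $D\subset\mathbb{C}$ containing the closed unit disc to which it extends holomorphically ($D=\mathbb{C}$ if $P$ is a polynomial or entire). $\mathscr{J}_P(0)$ is the open connected component of the filled Julia set of $P$ that contains the open unit disc and has $0$ as its attracting point, i.e. the connected component containing $0$ of the open set of $z\in D$ all of whose iterates $P^{\circ t}(z)$ are defined (stay in $D$) and satisfy $P^{\circ t}(z)\to0$. The critical angle $\vartheta$ is half of the maximal opening angle of sectors with vertex at $1$ and arbitrarily small radius lying entirely in $\mathscr{J}_P(0)$: $\vartheta$ is the supremum of all $\varphi_0\in(0,\pi]$ such that for some $r_0>0$ one has $\{1-re^{\mathbf{i}\varphi}:\ \varphi\in(-\varphi_0,\varphi_0),\ r\in(0,r_0)\}\subset\mathscr{J}_P(0)$. *)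

(* Defs.v *)
From Stdlib Require Export Reals.
From Coquelicot Require Export Coquelicot.

Open Scope R_scope.

Definition is_pgf (p : nat -> R) : Prop :=
  (forall n, 0 <= p n) /\ is_series p 1.

(* Values of f outside U are irrelevant. *)
Definition holomorphic (U : C -> Prop) (f : C -> C) : Prop :=
  open U /\ forall z : C, U z -> ex_derive (K := C_AbsRing) (V := C_NormedModule) f z.

(* f is a holomorphic function on U which agrees with sum_n p_n z^n wherever
   the latter is a priori defined, i.e. on the closed unit disc. *)
Definition hol_extension (p : nat -> R) (U : C -> Prop) (f : C -> C) : Prop :=
  holomorphic U f /\
  forall z : C, U z -> Cmod z <= 1 ->
    is_pseries (K := C_AbsRing) (V := C_NormedModule) (fun n => RtoC (p n)) z (f z).

Definition pgf_analytic_near (p : nat -> R) (z0 : C) : Prop :=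
  exists (U : C -> Prop) (f : C -> C), U z0 /\ hol_extension p U f.

Definition pgf_entire (p : nat -> R) : Prop :=
  exists f : C -> C, hol_extension p (fun _ => True) f.

Definition connected {T : UniformSpace} (S : T -> Prop) : Prop :=
  forall U V : T -> Prop, open U -> open V ->
    (forall x, S x -> U x \/ V x) ->
    (exists x, S x /\ U x) -> (exists x, S x /\ V x) ->
    exists x, S x /\ U x /\ V x.

(* y lies in the connected component of A containing x *)
Definition connected_component {T : UniformSpace} (A : T -> Prop) (x y : T) : Prop :=
  exists S : T -> Prop,
    connected S /\ (forall z, S z -> A z) /\ S x /\ S y.

(* P is the generating function of p, regarded as a holomorphic function on
   the domain D. *)
Definition pgf_on_domain (p : nat -> R) (D : C -> Prop) (P : C -> C) : Prop :=
  connected D /\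
  (forall z : C, Cmod z <= 1 -> D z) /\
  (pgf_entire p -> forall z : C, D z) /\
  hol_extension p D P.

Definition basin0 (D : C -> Prop) (P : C -> C) (z : C) : Prop :=
  (forall t : nat, D (Nat.iter t P z)) /\
  filterlim (fun t : nat => Nat.iter t P z) eventually (locally (RtoC 0)).

Definition julia0 (D : C -> Prop) (P : C -> C) : C -> Prop :=
  connected_component (basin0 D P) (RtoC 0).

Definition cis (phi : R) : C := (cos phi, sin phi).

Definition sector_in_julia0 (D : C -> Prop) (P : C -> C) (phi0 : R) : Prop :=
  exists r0 : R, 0 < r0 /\
    forall phi r : R, - phi0 < phi < phi0 -> 0 < r < r0 ->
      julia0 D P (1 - r * cis phi)%C.

Definition critical_angle (D : C -> Prop) (P : C -> C) : Rbar :=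
  Lub_Rbar (fun phi0 => 0 < phi0 <= PI /\ sector_in_julia0 D P phi0).

(* Main.v *)
Require Import Defs.
From Stdlib Require Import Reals Lra Lia Psatz Classical ClassicalEpsilon.
From Coquelicot Require Import Coquelicot.
Open Scope R_scope.

(** Near [1] write [s = |z - 1|] and [x = (|z|^2 - 1) / 2], so that [x < 0] is
    the unit disc, which lies in the basin of [0].  With [m = P'(1)] and
    [sigma = (P''(1) + m - m^2) / 2] (half the variance of [p]) one has
    [x(P z) = m x - sigma s^2 + O(s |x| + s^3)] and [s(P z) = m s + O(s^2)].
    Both [m > 1] and [sigma > 0] follow from [|P z - d z| <= (1 - d) |z|^2] on
    the closed disc.  The region [x <= eps s - kappa s^2], which contains small
    sectors of half-angle larger than [pi / 2], is then mapped into itself as long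
    as [x >= 0], while [s] grows geometrically; since [x < 0] once
    [s > eps / kappa], every orbit starting there enters the unit disc.

    The expansion of [P] to second order at [1], which lies on the boundary of the
    disc where [P] is a power series, comes from complex differentiability
    alone: by Goursat, [f z * c z] with [c z] the integral of [1 / (zeta - z)]
    over a square equals the integral of [f zeta / (zeta - z)], and both
    integrals can be expanded in powers of [z - 1]. *)

(** The unit disc already contains sectors at 1 of every half-angle below pi / 2, so the strict
    inequality is the whole difficulty. First-order information at the repelling fixed point 1
    cannot give it: to first order P multiplies z - 1 by the real number m, which preserves every
    sector at 1. What bends directions inwards is the term - sigma s^2: in one step the slope x / s
    drops by about sigma s / m. The correction - kappa s^2 in the region records the accumulated
    drop, and to leading order invariance asks for kappa (m^2 - m) <= sigma, so any small kappa
    leaves room for the error terms.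

    The height x is preferred to the real part of z - 1 because its zero set is exactly the unit
    circle: reaching x < 0 ends the argument. Until then the orbit stays in a disc around 1
    contained in D, so nothing about D farther out has to be controlled. *)

(** * Complex differentiability and continuity in terms of the modulus *)

Definition Cdiff (f : C -> C) (z : C) : Prop :=
  ex_derive (K := C_AbsRing) (V := C_NormedModule) f z.
Definition Ccont (f : C -> C) (z : C) : Prop :=
  continuous (T := C_UniformSpace) (U := C_UniformSpace) f z.

(** The balls of [C_UniformSpace] are squares, those of [Cmod] are discs; they compare up to a
    factor [sqrt 2], so they generate the same neighbourhoods. *)
Lemma locally_Cmod (z : C) (A : C -> Prop) :
  locally (T := C_UniformSpace) z A <->
  exists e, 0 < e /\ forall y, Cmod (y - z) < e -> A y.
Proof.
  split.
  - intros [e He]; exists e; split; [apply cond_pos|].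
    intros y Hy; apply He. now apply C_NormedModule_mixin_compat1.
  - intros [e [He H]].
    assert (Hs : 0 < sqrt 2) by (apply sqrt_lt_R0; lra).
    assert (Hp : 0 < e / sqrt 2) by (now apply Rdiv_lt_0_compat).
    exists (mkposreal _ Hp). intros y Hy. apply H.
    apply C_NormedModule_mixin_compat2 in Hy. simpl in Hy.
    replace e with (sqrt 2 * (e / sqrt 2)) by (field; lra). exact Hy.
Qed.

Lemma Ccont_eps (f : C -> C) (z : C) :
  Ccont f z <-> forall eps, 0 < eps ->
    exists e, 0 < e /\ forall y, Cmod (y - z) < e -> Cmod (f y - f z) < eps.
Proof.
  split.
  - intros H eps Heps.
    assert (L : locally (T := C_UniformSpace) (f z) (fun y => Cmod (y - f z) < eps))
      by (apply locally_Cmod; exists eps; auto).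
    apply H in L. unfold filtermap in L. now apply locally_Cmod in L.
  - intros H A HA. apply locally_Cmod in HA. destruct HA as [e [He HA]].
    destruct (H e He) as [d [Hd Hd']].
    apply locally_Cmod. exists d; split; auto.
Qed.

Lemma is_derive_C_eps (f : C -> C) (z l : C) :
  is_derive (K := C_AbsRing) (V := C_NormedModule) f z l <->
  forall eps, 0 < eps -> exists e, 0 < e /\ forall y, Cmod (y - z) < e ->
    Cmod (f y - f z - l * (y - z)) <= eps * Cmod (y - z).
Proof.
  split.
  - intros [_ H] eps Heps.
    specialize (H z (fun P HP => HP) (mkposreal eps Heps)).
    apply (proj2 (locally_C z _)), (locally_Cmod z) in H. destruct H as [e [He H]].
    exists e; split; auto. intros y Hy. specialize (H y Hy).
    rewrite (Cmult_comm l). exact H.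
  - intros H. split.
    + apply (is_linear_scal_l (K := C_AbsRing) (V := C_NormedModule) l).
    + intros x Hx.
      apply (is_filter_lim_locally_unique (K := C_AbsRing) (V := AbsRing_NormedModule C_AbsRing)) in Hx.
      subst x. intros eps. apply (proj1 (locally_C z _)), (locally_Cmod z).
      destruct (H eps (cond_pos eps)) as [e [He H']].
      exists e; split; auto. intros y Hy. specialize (H' y Hy).
      rewrite (Cmult_comm l) in H'. exact H'.
Qed.

Lemma Cdiff_Ccont f z : Cdiff f z -> Ccont f z.
Proof.
  intros H A HA. apply locally_C.
  apply (ex_derive_continuous (K := C_AbsRing) (V := C_NormedModule) f z H). exact HA.
Qed.

Lemma Cdiff_const a z : Cdiff (fun _ => a) z.
Proof. exists zero. apply (is_derive_const (K := C_AbsRing) (V := C_NormedModule)). Qed.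

(* Coquelicot equips [C] with two normed module structures over itself which
   differ by their uniform structure. *)
Lemma is_derive_AbsRing (f : C -> C) (z l : C) :
  is_derive (K := C_AbsRing) (V := AbsRing_NormedModule C_AbsRing) f z l ->
  is_derive (K := C_AbsRing) (V := C_NormedModule) f z l.
Proof.
  intros [_ H]. split; [apply (is_linear_scal_l (K := C_AbsRing) (V := C_NormedModule) l)|].
  exact H.
Qed.

Lemma is_derive_C_AbsRing (f : C -> C) (z l : C) :
  is_derive (K := C_AbsRing) (V := C_NormedModule) f z l ->
  is_derive (K := C_AbsRing) (V := AbsRing_NormedModule C_AbsRing) f z l.
Proof.
  intros [_ H]. split; [apply (is_linear_scal_l (K := C_AbsRing) (V := AbsRing_NormedModule C_AbsRing) l)|].
  exact H.
Qed.

Lemma Cdiff_id z : Cdiff (fun x => x) z.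
Proof. exists one. apply is_derive_AbsRing, (is_derive_id (K := C_AbsRing)). Qed.

Lemma Cdiff_minus f g z : Cdiff f z -> Cdiff g z -> Cdiff (fun x => f x - g x)%C z.
Proof. intros. now apply (ex_derive_minus (K := C_AbsRing) (V := C_NormedModule) f g). Qed.

Lemma Cdiff_plus f g z : Cdiff f z -> Cdiff g z -> Cdiff (fun x => f x + g x)%C z.
Proof. intros. now apply (ex_derive_plus (K := C_AbsRing) (V := C_NormedModule) f g). Qed.

Lemma Cdiff_mult f g z : Cdiff f z -> Cdiff g z -> Cdiff (fun x => f x * g x)%C z.
Proof.
  intros [a Ha] [b Hb]. eexists.
  apply is_derive_AbsRing.
  apply (is_derive_mult (K := C_AbsRing) f g z a b); auto using is_derive_C_AbsRing.
  intros; apply Cmult_comm.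
Qed.

(** The first-order remainder is exactly (y - z)^2 / (y z^2). Staying within |z| / 2 of z keeps |y
    z^2| above |z|^3 / 2, which explains both radii in the minimum. *)
Lemma Cinv_derive (z : C) : z <> 0 ->
  is_derive (K := C_AbsRing) (V := C_NormedModule) Cinv z (- / (z * z))%C.
Proof.
  intros Hz. apply is_derive_C_eps. intros eps Heps.
  assert (Hm : 0 < Cmod z) by (now apply Cmod_gt_0).
  assert (Hm3 : 0 < Cmod z * Cmod z * Cmod z) by (repeat apply Rmult_lt_0_compat; auto).
  exists (Rmin (Cmod z / 2) (eps * (Cmod z * Cmod z * Cmod z) / 2)). split.
  { apply Rmin_glb_lt; [lra|]. assert (0 < eps * (Cmod z * Cmod z * Cmod z)) by now apply Rmult_lt_0_compat. lra. }
  intros y Hy.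
  assert (H1 := Rlt_le_trans _ _ _ Hy (Rmin_l _ _)).
  assert (H2 := Rlt_le_trans _ _ _ Hy (Rmin_r _ _)).
  assert (Hyz : Cmod z <= Cmod (y - z) + Cmod y).
  { rewrite <- (Cmod_opp (y - z)). replace z with (- (y - z) + y)%C at 1 by ring. apply Cmod_triangle. }
  assert (Hy0 : y <> 0) by (apply Cmod_gt_0; lra).
  replace (/ y - / z - - / (z * z) * (y - z))%C with ((y - z) * (y - z) / (y * (z * z)))%C
    by (field; auto).
  rewrite Cmod_div by (repeat apply Cmult_neq_0; auto). rewrite !Cmod_mult.
  assert (Hden : Cmod z * Cmod z * Cmod z / 2 <= Cmod y * (Cmod z * Cmod z)) by nra.
  apply Rle_div_l; [lra|].
  assert (0 <= Cmod (y - z)) by apply Cmod_ge_0.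
  rewrite (Rmult_comm eps), Rmult_assoc. apply Rmult_le_compat_l; auto.
  apply Rle_trans with (eps * (Cmod z * Cmod z * Cmod z / 2)); [lra|].
  apply Rmult_le_compat_l; lra.
Qed.

Lemma Cdiff_inv (f : C -> C) z : Cdiff f z -> f z <> 0 -> Cdiff (fun x => / f x)%C z.
Proof.
  intros [a Ha] Hz. eexists.
  apply (is_derive_comp (K := C_AbsRing) (V := C_NormedModule) Cinv f z _ _ (Cinv_derive (f z) Hz)
    (is_derive_C_AbsRing f z a Ha)).
Qed.

(** * Integrals along rectangles *)

Definition IntC (h : R -> C) (a b : R) : C :=
  (RInt (fun t => fst (h t)) a b, RInt (fun t => snd (h t)) a b).

Definition Rcont (h : R -> C) (a b : R) : Prop :=
  forall t, a <= t <= b ->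
    continuous (fun t => fst (h t)) t /\ continuous (fun t => snd (h t)) t.

Lemma Rcont_ex (h : R -> C) a b : a <= b -> Rcont h a b ->
  ex_RInt (fun t => fst (h t)) a b /\ ex_RInt (fun t => snd (h t)) a b.
Proof.
  intros Hab H. split; apply (ex_RInt_continuous (V := R_CompleteNormedModule));
    intros z; rewrite Rmin_left, Rmax_right by auto; intros Hz; now apply H.
Qed.

Lemma Rcont_sub (h : R -> C) a b a' b' : a <= a' -> b' <= b -> Rcont h a b -> Rcont h a' b'.
Proof. intros Ha Hb H t Ht. apply H. lra. Qed.

Lemma IntC_Chasles h a m b : a <= m <= b -> Rcont h a b ->
  IntC h a b = (IntC h a m + IntC h m b)%C.
Proof.
  intros Hm H.
  destruct (Rcont_ex h a m) as [A1 A2]; [lra|now apply Rcont_sub with a b; try lra|].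
  destruct (Rcont_ex h m b) as [B1 B2]; [lra|now apply Rcont_sub with a b; try lra|].
  unfold IntC, Cplus; simpl; f_equal; symmetry.
  - now apply (RInt_Chasles (V := R_CompleteNormedModule) (fun t => fst (h t))).
  - now apply (RInt_Chasles (V := R_CompleteNormedModule) (fun t => snd (h t))).
Qed.

Lemma IntC_ext h g a b : a <= b -> (forall t, a <= t <= b -> h t = g t) -> IntC h a b = IntC g a b.
Proof.
  intros Hab H. unfold IntC; f_equal; apply RInt_ext; intros t;
    rewrite Rmin_left, Rmax_right by auto; intros Ht; rewrite H; auto; lra.
Qed.

Lemma IntC_plus h g a b : a <= b -> Rcont h a b -> Rcont g a b ->
  IntC (fun t => h t + g t)%C a b = (IntC h a b + IntC g a b)%C.
Proof.
  intros Hab Hh Hg.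
  destruct (Rcont_ex h a b Hab Hh) as [A1 A2].
  destruct (Rcont_ex g a b Hab Hg) as [B1 B2].
  unfold IntC, Cplus; simpl; f_equal.
  - now apply (RInt_plus (V := R_CompleteNormedModule) (fun t => fst (h t)) (fun t => fst (g t))).
  - now apply (RInt_plus (V := R_CompleteNormedModule) (fun t => snd (h t)) (fun t => snd (g t))).
Qed.

Lemma IntC_scal k h a b : a <= b -> Rcont h a b ->
  IntC (fun t => k * h t)%C a b = (k * IntC h a b)%C.
Proof.
  intros Hab Hh.
  destruct (Rcont_ex h a b Hab Hh) as [A1 A2].
  unfold IntC, Cmult; simpl; f_equal.
  - apply is_RInt_unique.
    apply (is_RInt_minus (V := R_NormedModule) (fun t => fst k * fst (h t)) (fun t => snd k * snd (h t)));
      apply (is_RInt_scal (V := R_NormedModule)); now apply (RInt_correct (V := R_CompleteNormedModule)).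
  - apply is_RInt_unique.
    apply (is_RInt_plus (V := R_NormedModule) (fun t => fst k * snd (h t)) (fun t => snd k * fst (h t)));
      apply (is_RInt_scal (V := R_NormedModule)); now apply (RInt_correct (V := R_CompleteNormedModule)).
Qed.

(** Estimating the two components separately would lose a constant factor. Instead the pair of
    integrals is recognised as the integral of [h] in the real normed space [C], whose norm is
    [Cmod]. *)
Lemma IntC_bound h a b M : a <= b -> Rcont h a b -> (forall t, a <= t <= b -> Cmod (h t) <= M) ->
  Cmod (IntC h a b) <= (b - a) * M.
Proof.
  intros Hab Hh HM. destruct (Rcont_ex h a b Hab Hh) as [A1 A2].
  rewrite Cmod_norm.
  apply (norm_RInt_le_const (V := C_R_NormedModule) h a b); auto.
  - intros t Ht. rewrite <- Cmod_norm. now apply HM.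
  - apply (is_RInt_fct_extend_pair (U := R_NormedModule) (V := R_NormedModule) h);
      now apply (RInt_correct (V := R_CompleteNormedModule)).
Qed.

Lemma IntC_const k a b : IntC (fun _ => k) a b = (RtoC (b - a) * k)%C.
Proof.
  unfold IntC. rewrite !RInt_const. unfold scal; simpl; unfold mult; simpl.
  unfold Cmult; simpl. f_equal; ring.
Qed.

Lemma Ccont_line (h : C -> C) (g : R -> C) t :
  (forall s, Cmod (g s - g t) <= Rabs (s - t)) -> Ccont h (g t) ->
  continuous (fun t => fst (h (g t))) t /\ continuous (fun t => snd (h (g t))) t.
Proof.
  intros Hg Hh.
  assert (K : forall A, locally (T := C_UniformSpace) (h (g t)) A -> locally t (fun s => A (h (g s)))).
  { intros A HA. apply Hh in HA. apply locally_Cmod in HA. destruct HA as [e [He HA]].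
    exists (mkposreal e He). intros s Hs. apply HA.
    eapply Rle_lt_trans; [apply Hg|]. exact Hs. }
  split; intros A HA; destruct HA as [e HA].
  - apply (K (fun z => A (fst z))). exists e. intros y Hy. apply HA, Hy.
  - apply (K (fun z => A (snd z))). exists e. intros y Hy. apply HA, Hy.
Qed.

Lemma Cmod_horiz (s t y : R) : Cmod ((s, y) - (t, y)) = Rabs (s - t).
Proof. replace ((s, y) - (t, y))%C with (RtoC (s - t)); [apply Cmod_R|].
  unfold RtoC, Cminus, Cplus, Copp; simpl; f_equal; ring. Qed.

Lemma Cmod_vert (s t x : R) : Cmod ((x, s) - (x, t)) = Rabs (s - t).
Proof. replace ((x, s) - (x, t))%C with (Ci * RtoC (s - t))%C.
  rewrite Cmod_mult, Cmod_Ci, Cmod_R; ring.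
  unfold RtoC, Ci, Cmult, Cminus, Cplus, Copp; simpl; f_equal; ring. Qed.

Lemma Rcont_horiz h y a b : (forall x, a <= x <= b -> Ccont h (x, y)) -> Rcont (fun x => h (x, y)) a b.
Proof.
  intros H t Ht. apply (Ccont_line h (fun x => (x, y))); auto.
  intros s. rewrite Cmod_horiz. lra.
Qed.

Lemma Rcont_vert h x a b : (forall y, a <= y <= b -> Ccont h (x, y)) -> Rcont (fun y => h (x, y)) a b.
Proof.
  intros H t Ht. apply (Ccont_line h (fun y => (x, y))); auto.
  intros s. rewrite Cmod_vert. lra.
Qed.

(** The counterclockwise contour integral: bottom and right sides count positively, top and left
    negatively, and [Ci] is the derivative of the vertical parametrisations. *)
Definition rect_integral (h : C -> C) (a b c d : R) : C :=
  (IntC (fun x => h (x, c)) a b + Ci * IntC (fun y => h (b, y)) c d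
   - IntC (fun x => h (x, d)) a b - Ci * IntC (fun y => h (a, y)) c d)%C.

Definition on_boundary (Q : C -> Prop) (a b c d : R) : Prop :=
  (forall x, a <= x <= b -> Q (x, c) /\ Q (x, d)) /\
  (forall y, c <= y <= d -> Q (a, y) /\ Q (b, y)).

Lemma on_boundary_Rcont h a b c d : on_boundary (Ccont h) a b c d ->
  Rcont (fun x => h (x, c)) a b /\ Rcont (fun x => h (x, d)) a b /\
  Rcont (fun y => h (a, y)) c d /\ Rcont (fun y => h (b, y)) c d.
Proof.
  intros [H1 H2]. split; [|split; [|split]]; try apply (Rcont_horiz h); try apply (Rcont_vert h);
   auto; intros; try now apply H1. all: now apply H2.
Qed.

(** The common vertical side cancels as a term, so continuity is asked only on the two sides that
    are cut. *)
Lemma rect_integral_split_x h a m b c d : a <= m <= b -> 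
  (forall x, a <= x <= b -> Ccont h (x, c)) ->
  (forall x, a <= x <= b -> Ccont h (x, d)) ->
  rect_integral h a b c d = (rect_integral h a m c d + rect_integral h m b c d)%C.
Proof.
  intros Hm H1 H2. unfold rect_integral.
  rewrite (IntC_Chasles (fun x => h (x, c)) a m b), (IntC_Chasles (fun x => h (x, d)) a m b);
   auto using Rcont_horiz. ring.
Qed.

Lemma rect_integral_split_y h a b c m d : c <= m <= d -> 
  (forall y, c <= y <= d -> Ccont h (a, y)) ->
  (forall y, c <= y <= d -> Ccont h (b, y)) ->
  rect_integral h a b c d = (rect_integral h a b c m + rect_integral h a b m d)%C.
Proof.
  intros Hm H1 H2. unfold rect_integral.
  rewrite (IntC_Chasles (fun y => h (a, y)) c m d), (IntC_Chasles (fun y => h (b, y)) c m d);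
   auto using Rcont_vert. ring.
Qed.

Lemma rect_integral_plus h g a b c d : a <= b -> c <= d ->
  on_boundary (Ccont h) a b c d -> on_boundary (Ccont g) a b c d ->
  rect_integral (fun z => h z + g z)%C a b c d = (rect_integral h a b c d + rect_integral g a b c d)%C.
Proof.
  intros Hab Hcd Hh Hg.
  destruct (on_boundary_Rcont _ _ _ _ _ Hh) as [? [? [? ?]]].
  destruct (on_boundary_Rcont _ _ _ _ _ Hg) as [? [? [? ?]]].
  unfold rect_integral. rewrite !IntC_plus by auto. ring.
Qed.

Lemma rect_integral_scal k h a b c d : a <= b -> c <= d ->
  on_boundary (Ccont h) a b c d ->
  rect_integral (fun z => k * h z)%C a b c d = (k * rect_integral h a b c d)%C.
Proof.
  intros Hab Hcd Hh.
  destruct (on_boundary_Rcont _ _ _ _ _ Hh) as [? [? [? ?]]].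
  unfold rect_integral. rewrite !IntC_scal by auto. ring.
Qed.

Lemma rect_integral_ext h g a b c d : a <= b -> c <= d ->
  on_boundary (fun z => h z = g z) a b c d -> rect_integral h a b c d = rect_integral g a b c d.
Proof.
  intros Hab Hcd [H1 H2]. unfold rect_integral.
  rewrite (IntC_ext (fun x => h (x, c)) (fun x => g (x, c))),
   (IntC_ext (fun x => h (x, d)) (fun x => g (x, d))),
   (IntC_ext (fun x => h (a, x)) (fun x => g (a, x))),
   (IntC_ext (fun x => h (b, x)) (fun x => g (b, x))); auto; intros; try now apply H1.
  all: now apply H2.
Qed.

Lemma rect_integral_bound h a b c d M : a <= b -> c <= d ->
  on_boundary (Ccont h) a b c d -> on_boundary (fun z => Cmod (h z) <= M) a b c d ->
  Cmod (rect_integral h a b c d) <= 2 * ((b - a) + (d - c)) * M.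
Proof.
  intros Hab Hcd Hh [M1 M2].
  destruct (on_boundary_Rcont _ _ _ _ _ Hh) as [C1 [C2 [C3 C4]]].
  unfold rect_integral, Cminus.
  assert (A1 := IntC_bound _ _ _ M Hab C1 (fun t Ht => proj1 (M1 t Ht))).
  assert (A2 := IntC_bound _ _ _ M Hab C2 (fun t Ht => proj2 (M1 t Ht))).
  assert (A3 := IntC_bound _ _ _ M Hcd C3 (fun t Ht => proj1 (M2 t Ht))).
  assert (A4 := IntC_bound _ _ _ M Hcd C4 (fun t Ht => proj2 (M2 t Ht))).
  eapply Rle_trans; [apply Cmod_triangle|]. rewrite Cmod_opp, Cmod_mult, Cmod_Ci.
  eapply Rle_trans; [apply Rplus_le_compat_r, Cmod_triangle|]. rewrite Cmod_opp.
  eapply Rle_trans; [apply Rplus_le_compat_r, Rplus_le_compat_r, Cmod_triangle|]. rewrite Cmod_mult, Cmod_Ci.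
  lra.
Qed.

(** The one case of Cauchy's theorem that the bisection argument needs beforehand; here the
    integrals are elementary and computed outright. *)
Lemma rect_integral_affine k l a b c d : a <= b -> c <= d -> rect_integral (fun z => k + l * z)%C a b c d = 0.
Proof.
  intros Hab Hcd.
  assert (Hi : forall z, Ccont (fun z => z) z) by (intros; apply Cdiff_Ccont, Cdiff_id).
  assert (Hc : forall z, Ccont (fun _ => k) z) by (intros; apply Cdiff_Ccont, Cdiff_const).
  assert (Hl : forall z, Ccont (fun z => l * z)%C z) by
    (intros; apply Cdiff_Ccont, Cdiff_mult; [apply Cdiff_const|apply Cdiff_id]).
  rewrite (rect_integral_plus (fun _ => k) (fun z => l * z)%C), (rect_integral_scal l (fun z => z)); auto; try (split; auto).
  assert (Hid : forall u v, RInt (fun x => x) u v = (v * v - u * u) / 2).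
  { intros u v. apply is_RInt_unique.
    replace ((v * v - u * u) / 2) with (minus (v * v / 2) (u * u / 2))
      by (unfold minus, plus, opp; simpl; lra).
    apply (is_RInt_derive (fun x => x * x / 2) (fun x => x)); intros x _.
    - auto_derive; auto; lra.
    - apply continuous_id. }
  replace (rect_integral (fun _ => k) a b c d) with (RtoC 0) by (unfold rect_integral; rewrite !IntC_const; ring).
  replace (rect_integral (fun z => z) a b c d) with (RtoC 0).
  2:{ unfold rect_integral, IntC; simpl. rewrite !Hid, !RInt_const.
      unfold scal; simpl; unfold mult; simpl. unfold RtoC, Ci, Cminus, Cplus, Copp, Cmult; simpl.
      f_equal; field. }
  ring.
Qed.

(** * Goursat's theorem and the second-order expansion *)

Lemma nested_intervals (a b : nat -> R) :
  (forall n, a n <= a (S n)) -> (forall n, b (S n) <= b n) -> (forall n, a n <= b n) ->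
  exists x, forall n, a n <= x <= b n.
Proof.
  intros Ha Hb Hab.
  assert (Ha' : forall n k, a n <= a (n + k)%nat).
  { intros n k; induction k; [rewrite Nat.add_0_r; lra|].
    rewrite Nat.add_succ_r. specialize (Ha (n + k)%nat). lra. }
  assert (Hb' : forall n k, b (n + k)%nat <= b n).
  { intros n k; induction k; [rewrite Nat.add_0_r; lra|].
    rewrite Nat.add_succ_r. specialize (Hb (n + k)%nat). lra. }
  assert (H : forall n m, a n <= b m).
  { intros n m. specialize (Ha' n m). specialize (Hb' m n). specialize (Hab (n + m)%nat).
    rewrite (Nat.add_comm m n) in Hb'. lra. }
  destruct (completeness (fun x => exists n, x = a n)) as [x [Hx1 Hx2]].
  - exists (b O). intros y [n ->]. apply H.
  - exists (a O), O; auto.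
  - exists x. intros n; split.
    + apply Hx1; exists n; auto.
    + apply Hx2. intros y [m ->]. apply H.
Qed.

(** The four quarters add up to the whole, so one of them carries at least a quarter of the modulus.
    Writing the quarter as corner plus half-widths lets the iteration track corners only. *)
Lemma rect_integral_quarter h a b c d : a <= b -> c <= d ->
  (forall x y, a <= x <= b -> c <= y <= d -> Ccont h (x, y)) ->
  exists a' c', (a' = a \/ a' = (a + b) / 2) /\ (c' = c \/ c' = (c + d) / 2) /\
    Cmod (rect_integral h a b c d) <= 4 * Cmod (rect_integral h a' (a' + (b - a) / 2) c' (c' + (d - c) / 2)).
Proof.
  intros Hab Hcd H.
  set (m := (a + b) / 2). set (k := (c + d) / 2).
  assert (Hm : a <= m <= b) by (unfold m; lra). assert (Hk : c <= k <= d) by (unfold k; lra).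
  assert (E : rect_integral h a b c d = (rect_integral h a m c k + rect_integral h a m k d + (rect_integral h m b c k + rect_integral h m b k d))%C).
  { rewrite (rect_integral_split_x h a m b c d), (rect_integral_split_y h a m c k d), (rect_integral_split_y h m b c k d); auto;
     intros; apply H; lra. }
  assert (T : Cmod (rect_integral h a b c d) <= Cmod (rect_integral h a m c k) + Cmod (rect_integral h a m k d) +
    (Cmod (rect_integral h m b c k) + Cmod (rect_integral h m b k d))).
  { rewrite E. eapply Rle_trans; [apply Cmod_triangle|]. apply Rplus_le_compat; apply Cmod_triangle. }
  assert (E1 : a + (b - a) / 2 = m) by (unfold m; lra).
  assert (E2 : m + (b - a) / 2 = b) by (unfold m; lra).
  assert (E3 : c + (d - c) / 2 = k) by (unfold k; lra).
  assert (E4 : k + (d - c) / 2 = d) by (unfold k; lra).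
  destruct (Rle_dec (Cmod (rect_integral h a b c d)) (4 * Cmod (rect_integral h a m c k))).
  { exists a, c. rewrite E1, E3. auto. }
  destruct (Rle_dec (Cmod (rect_integral h a b c d)) (4 * Cmod (rect_integral h a m k d))).
  { exists a, k. rewrite E1, E4. auto. }
  destruct (Rle_dec (Cmod (rect_integral h a b c d)) (4 * Cmod (rect_integral h m b c k))).
  { exists m, c. rewrite E2, E3. auto. }
  exists m, k. rewrite E2, E4. split; auto; split; auto. lra.
Qed.

(* Subtracting the affine part of [h], whose integral vanishes, leaves an
   integrand of size [o(diameter)]. *)
Lemma goursat_local h x y eps : 0 < eps -> Cdiff h (x, y) ->
  exists e, 0 < e /\ forall a b c d, a <= x <= b -> c <= y <= d -> (b - a) + (d - c) < e ->
   (forall x y, a <= x <= b -> c <= y <= d -> Ccont h (x, y)) ->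
   Cmod (rect_integral h a b c d) <= eps * ((b - a) + (d - c)) ^ 2.
Proof.
  intros Heps [l Hl]. 
  destruct (proj1 (is_derive_C_eps h (x, y) l) Hl (eps / 2)) as [e [He H]]; [lra|].
  exists e; split; auto. intros a b c d Hx Hy Hd Hc.
  set (z0 := (x, y) : C) in *.
  set (g := fun z => (h z - (h z0 - l * z0 + l * z))%C).
  assert (Hdist : forall u v, a <= u <= b -> c <= v <= d -> Cmod ((u, v) - z0) <= (b - a) + (d - c)).
  { intros u v Hu Hv. replace ((u, v) - z0)%C with (((u, v) - (x, v)) + ((x, v) - (x, y)))%C
      by (unfold z0; ring).
    eapply Rle_trans; [apply Cmod_triangle|]. rewrite Cmod_horiz, Cmod_vert.
    apply Rplus_le_compat; apply Rabs_le; lra. }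
  assert (Haff : forall z, Ccont (fun z => (h z0 - l * z0 + l * z))%C z).
  { intros z. apply Cdiff_Ccont.
    assert (E : Cdiff (fun z => (h z0 - l * z0) - ((- l) * z))%C z).
    { apply Cdiff_minus; [apply Cdiff_const|]. apply Cdiff_mult; [apply Cdiff_const|apply Cdiff_id]. }
    eapply ex_derive_ext; [|exact E]. intros t; simpl. ring. }
  assert (Hcg : forall u v, a <= u <= b -> c <= v <= d -> Ccont g (u, v)).
  { intros u v Hu Hv. apply Ccont_eps. intros ep Hep.
    destruct (proj1 (Ccont_eps _ _) (Hc u v Hu Hv) (ep / 2)) as [e1 [He1 H1]]; [lra|].
    destruct (proj1 (Ccont_eps _ _) (Haff (u, v)) (ep / 2)) as [e2 [He2 H2]]; [lra|].
    exists (Rmin e1 e2); split; [now apply Rmin_pos|].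
    intros z Hz. 
    assert (A1 := H1 z (Rlt_le_trans _ _ _ Hz (Rmin_l _ _))).
    assert (A2 := H2 z (Rlt_le_trans _ _ _ Hz (Rmin_r _ _))). simpl in A2.
    unfold g. 
    replace (h z - (h z0 - l * z0 + l * z) - (h (u, v) - (h z0 - l * z0 + l * (u, v))))%C
      with ((h z - h (u, v)) + - (h z0 - l * z0 + l * z - (h z0 - l * z0 + l * (u, v))))%C by ring.
    eapply Rle_lt_trans; [apply Cmod_triangle|]. rewrite Cmod_opp. lra. }
  assert (EJ : rect_integral h a b c d = rect_integral g a b c d).
  { rewrite (rect_integral_ext h (fun z => g z + (h z0 - l * z0 + l * z))%C) by
      (try lra; split; intros; split; unfold g; ring).
    rewrite (rect_integral_plus g (fun z => (h z0 - l * z0) + l * z)%C).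
    - rewrite rect_integral_affine by lra. ring.
    - lra.
    - lra.
    - split; intros; split; apply Hcg; lra.
    - split; intros; split; apply Haff. }
  rewrite EJ.
  eapply Rle_trans; [apply (rect_integral_bound g a b c d (eps / 2 * ((b - a) + (d - c))))|].
  - lra.
  - lra.
  - split; intros; split; apply Hcg; lra.
  - assert (Hg : forall u v, a <= u <= b -> c <= v <= d -> Cmod (g (u, v)) <= eps / 2 * (b - a + (d - c))).
    { intros u v Hu Hv. specialize (Hdist u v Hu Hv).
      unfold g. replace (h (u, v) - (h z0 - l * z0 + l * (u, v)))%C with
       (h (u, v) - h z0 - l * ((u, v) - z0))%C by ring.
      eapply Rle_trans; [apply H; lra|]. apply Rmult_le_compat_l; lra. }
    split; intros; split; apply Hg; lra.
  - right; field.
Qed.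

(** By bisection: the n-th rectangle carries at least I / 4^n, whereas differentiability at the
    common point bounds its integral by eps L^2 / 4^n for large n. The powers of 4 cancel, leaving I
    <= eps L^2 for every eps. *)
Lemma goursat h a b c d : a <= b -> c <= d ->
  (forall x y, a <= x <= b -> c <= y <= d -> Cdiff h (x, y)) -> rect_integral h a b c d = 0.
Proof.
  intros Hab Hcd Hd.
  assert (Hc : forall x y, a <= x <= b -> c <= y <= d -> Ccont h (x, y)) by (intros; now apply Cdiff_Ccont, Hd).
  apply Cmod_eq_0.
  set (I := Cmod (rect_integral h a b c d)).
  set (w := fun n : nat => (b - a) / 2 ^ n). set (k := fun n : nat => (d - c) / 2 ^ n).
  assert (Hw : forall n, 0 <= w n).
  { intros n. apply Rmult_le_pos; [lra|]. left; apply Rinv_0_lt_compat, pow_lt; lra. }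
  assert (Hk : forall n, 0 <= k n).
  { intros n. apply Rmult_le_pos; [lra|]. left; apply Rinv_0_lt_compat, pow_lt; lra. }
  assert (HwS : forall n, w (S n) = w n / 2).
  { intros n; unfold w; simpl; field; apply pow_nonzero; lra. }
  assert (HkS : forall n, k (S n) = k n / 2).
  { intros n; unfold k; simpl; field; apply pow_nonzero; lra. }
  set (ok := fun n (p : R * R) => a <= fst p /\ fst p + w n <= b /\ c <= snd p /\ snd p + k n <= d /\
     I <= 4 ^ n * Cmod (rect_integral h (fst p) (fst p + w n) (snd p) (snd p + k n))).
  assert (step : forall n p, ok n p -> exists p', ok (S n) p' /\
     fst p <= fst p' /\ fst p' + w (S n) <= fst p + w n /\
     snd p <= snd p' /\ snd p' + k (S n) <= snd p + k n).
  { intros n [u v] [H1 [H2 [H3 [H4 H5]]]]. simpl in *.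
    specialize (Hw n). specialize (Hk n).
    destruct (rect_integral_quarter h u (u + w n) v (v + k n)) as [u' [v' [Hu [Hv Hq]]]];
      try lra; [intros; apply Hc; lra|].
    exists (u', v'). unfold ok; simpl. rewrite HwS, HkS.
    replace (u + w n - u) with (w n) in Hq by ring.
    replace (v + k n - v) with (k n) in Hq by ring.
    assert (I <= 4 * 4 ^ n * Cmod (rect_integral h u' (u' + w n / 2) v' (v' + k n / 2))).
    { eapply Rle_trans; [apply H5|]. rewrite (Rmult_comm 4), Rmult_assoc.
      apply Rmult_le_compat_l; [apply pow_le; lra|exact Hq]. }
    destruct Hu, Hv; repeat split; auto; lra. }
  (* Description turns the existence of a good quarter into a function; the subset type carries the
     invariant, so the sequence can be defined by plain recursion. *)
  assert (next : forall n (p : {p | ok n p}), {q : {p | ok (S n) p} |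
     fst (proj1_sig p) <= fst (proj1_sig q) /\ fst (proj1_sig q) + w (S n) <= fst (proj1_sig p) + w n /\
     snd (proj1_sig p) <= snd (proj1_sig q) /\ snd (proj1_sig q) + k (S n) <= snd (proj1_sig p) + k n}).
  { intros n [p Hp]. destruct (constructive_indefinite_description _ (step n p Hp)) as [q [Hq1 Hq2]].
    exists (exist _ q Hq1). exact Hq2. }
  assert (H0 : ok O (a, c)).
  { unfold ok, w, k; simpl. replace (a + (b - a) / 1) with b by field.
    replace (c + (d - c) / 1) with d by field. unfold I. repeat split; lra. }
  set (s := fix s n : {p | ok n p} := match n with O => exist _ (a, c) H0 | S n => proj1_sig (next n (s n)) end).
  assert (Hs : forall n, s (S n) = proj1_sig (next n (s n))) by reflexivity.
  assert (Hmono : forall n, 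
     fst (proj1_sig (s n)) <= fst (proj1_sig (s (S n))) /\ fst (proj1_sig (s (S n))) + w (S n) <= fst (proj1_sig (s n)) + w n /\
     snd (proj1_sig (s n)) <= snd (proj1_sig (s (S n))) /\ snd (proj1_sig (s (S n))) + k (S n) <= snd (proj1_sig (s n)) + k n).
  { intros n. rewrite Hs. exact (proj2_sig (next n (s n))). }
  destruct (nested_intervals (fun n => fst (proj1_sig (s n))) (fun n => fst (proj1_sig (s n)) + w n)) as [x Hx];
   [intros n; apply Hmono|intros n; apply Hmono|intros n; specialize (Hw n); lra|].
  destruct (nested_intervals (fun n => snd (proj1_sig (s n))) (fun n => snd (proj1_sig (s n)) + k n)) as [y Hy];
   [intros n; apply Hmono|intros n; apply Hmono|intros n; specialize (Hk n); lra|].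
  assert (Hxy : a <= x <= b /\ c <= y <= d).
  { destruct (proj2_sig (s O)) as [A1 [A2 [A3 [A4 _]]]]. specialize (Hx O); specialize (Hy O). lra. }
  set (L := (b - a) + (d - c)).
  assert (HL : 0 <= L) by (unfold L; lra).
  assert (Hall : forall eps, 0 < eps -> I <= eps * L ^ 2).
  { intros eps Heps.
    destruct (goursat_local h x y eps Heps) as [e [He Hl]]; [apply Hd; apply Hxy|].
    assert (Hn : exists n : nat, L / 2 ^ n < e).
    { destruct (pow_lt_1_zero (1 / 2)) with (y := e / (L + 1)) as [n Hn].
      - rewrite Rabs_pos_eq; lra.
      - apply Rdiv_lt_0_compat; lra.
      - exists n. specialize (Hn n (le_n n)). rewrite Rabs_pos_eq in Hn by (apply pow_le; lra).
        unfold Rdiv in Hn at 1. rewrite Rmult_1_l, pow_inv in Hn by lra.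
        apply Rle_lt_trans with ((L + 1) * / 2 ^ n).
        + apply Rmult_le_compat_r; [left; apply Rinv_0_lt_compat, pow_lt|]; lra.
        + apply Rmult_lt_compat_l with (r := L + 1) in Hn; [|lra].
          replace ((L + 1) * (e / (L + 1))) with e in Hn by (field; lra). exact Hn. }
    destruct Hn as [n Hn].
    destruct (proj2_sig (s n)) as [A1 [A2 [A3 [A4 A5]]]].
    specialize (Hl (fst (proj1_sig (s n))) (fst (proj1_sig (s n)) + w n) (snd (proj1_sig (s n))) (snd (proj1_sig (s n)) + k n)
       (Hx n) (Hy n)).
    assert (EL : fst (proj1_sig (s n)) + w n - fst (proj1_sig (s n)) + (snd (proj1_sig (s n)) + k n - snd (proj1_sig (s n))) = L / 2 ^ n).
    { unfold L, w, k. field. apply pow_nonzero; lra. }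
    rewrite EL in Hl. 
    eapply Rle_trans; [apply A5|].
    eapply Rle_trans; [apply Rmult_le_compat_l; [apply pow_le; lra|apply Hl; auto]|].
    - intros u v Hu Hv; apply Hc; lra.
    - right. replace (4 ^ n) with (2 ^ n * 2 ^ n) by (rewrite <- Rpow_mult_distr; f_equal; lra).
      field. apply pow_nonzero; lra. }
  assert (HI : 0 <= I) by apply Cmod_ge_0.
  apply Rle_antisym; [|exact HI].
  apply Rnot_lt_le. intros HIp.
  (* With this eps the bound is at most I / 2; the added 1 covers the degenerate rectangle L = 0. *)
  assert (Hp : 0 < I / (2 * (L ^ 2 + 1))) by (apply Rdiv_lt_0_compat; nra).
  specialize (Hall _ Hp).
  assert (I / (2 * (L ^ 2 + 1)) * L ^ 2 <= I / 2).
  { replace (I / 2) with (I / (2 * (L ^ 2 + 1)) * (L ^ 2 + 1)) by (field; nra).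
    apply Rmult_le_compat_l; lra. }
  lra.
Qed.

Lemma pair_neq (x y u v : R) : x <> u \/ y <> v -> ((x, y) : C) <> (u, v).
Proof. intros H E; injection E; intros; lra. Qed.

Lemma Cmod_le_1 (x y : R) : Cmod (x, y) <= Rabs x + Rabs y.
Proof.
  replace ((x, y) : C) with (RtoC x + Ci * RtoC y)%C by
   (unfold RtoC, Ci, Cmult, Cplus; simpl; f_equal; ring).
  eapply Rle_trans; [apply Cmod_triangle|]. rewrite Cmod_mult, Cmod_Ci, !Cmod_R. lra.
Qed.

(* The rectangle is cut into a small square around the singular point and four
   rectangles to which [goursat] applies. *)
Lemma goursat_removable h a b c d x0 y0 M e0 : a < x0 < b -> c < y0 < d -> 0 < e0 ->
  (forall x y, a <= x <= b -> c <= y <= d -> x <> x0 \/ y <> y0 -> Cdiff h (x, y)) ->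
  (forall z, z <> (x0, y0) -> Cmod (z - (x0, y0)) < e0 -> Cmod (h z) <= M) ->
  rect_integral h a b c d = 0.
Proof.
  intros Hx Hy He0 Hd HM.
  assert (Hc : forall x y, a <= x <= b -> c <= y <= d -> x <> x0 \/ y <> y0 -> Ccont h (x, y))
    by (intros; now apply Cdiff_Ccont, Hd).
  set (e1 := Rmin (e0 / 4) (Rmin (Rmin (x0 - a) (b - x0)) (Rmin (y0 - c) (d - y0)))).
  assert (He1 : 0 < e1) by (unfold e1; repeat apply Rmin_pos; lra).
  assert (B1 : e1 <= e0 / 4 /\ e1 <= x0 - a /\ e1 <= b - x0 /\ e1 <= y0 - c /\ e1 <= d - y0).
  { unfold e1, Rmin. repeat destruct (Rle_dec _ _); lra. }
  assert (Hall : forall e, 0 < e <= e1 -> Cmod (rect_integral h a b c d) <= 8 * e * Rabs M).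
  { intros e He.
    assert (E : rect_integral h a b c d = rect_integral h (x0 - e) (x0 + e) (y0 - e) (y0 + e)).
    { rewrite (rect_integral_split_x h a (x0 - e) b c d), (rect_integral_split_x h (x0 - e) (x0 + e) b c d) by
        (try (intros; apply Hc; lra); lra).
      rewrite (rect_integral_split_y h (x0 - e) (x0 + e) c (y0 - e) d), (rect_integral_split_y h (x0 - e) (x0 + e) (y0 - e) (y0 + e) d) by
        (try (intros; apply Hc; lra); lra).
      rewrite (goursat h a), (goursat h (x0 + e) b), (goursat h _ _ c (y0 - e)), (goursat h _ _ (y0 + e) d);
        try lra; try (intros; apply Hd; lra). ring. }
    rewrite E.
    eapply Rle_trans; [apply (rect_integral_bound h _ _ _ _ (Rabs M)); try lra|].
    - split; intros; split; apply Hc; lra.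
    - assert (K : forall x y, Rabs (x - x0) <= e -> Rabs (y - y0) <= e -> x <> x0 \/ y <> y0 ->
         Cmod (h (x, y)) <= Rabs M).
      { intros x y H1 H2 H3. eapply Rle_trans; [apply HM|apply Rle_abs].
        - now apply pair_neq.
        - eapply Rle_lt_trans; [apply (Cmod_le_1 (x - x0) (y - y0))|]. lra. }
      split; intros; split; apply K; try (apply Rabs_le; lra); lra.
    - right; ring. }
  apply Cmod_eq_0. apply Rle_antisym; [|apply Cmod_ge_0].
  apply Rnot_lt_le; intros Hp.
  set (q := Cmod (rect_integral h a b c d)) in *.
  assert (HM0 := Rabs_pos M).
  (* Small enough that 8 e |M| <= q / 2, against q > 0. *)
  set (e := Rmin e1 (q / (16 * (Rabs M + 1)))).
  assert (He : 0 < e <= e1) by (split; [apply Rmin_pos; auto; apply Rdiv_lt_0_compat; lra|apply Rmin_l]).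
  specialize (Hall e He).
  assert (e * (16 * (Rabs M + 1)) <= q).
  { apply Rle_div_r; [lra|]. apply Rmin_r. }
  nra.
Qed.

Lemma Csub_neq_0 (z w : C) : z <> w -> (z - w)%C <> 0.
Proof. intros H E. apply H. replace z with (z - w + w)%C by ring. rewrite E; ring. Qed.

(** Replacing [f z] by [f z - f z0] turns the integrand into a difference quotient, bounded near z0
    by |l| + 1 with l the derivative there, so [goursat_removable] makes its integral vanish. *)
Lemma cauchy_rectangle f a b c d x0 y0 : a < x0 < b -> c < y0 < d ->
  (forall x y, a <= x <= b -> c <= y <= d -> Cdiff f (x, y)) ->
  rect_integral (fun z => f z * / (z - (x0, y0)))%C a b c d = (f (x0, y0) * rect_integral (fun z => / (z - (x0, y0)))%C a b c d)%C.
Proof.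
  intros Hx Hy Hd. set (z0 := (x0, y0) : C).
  assert (Hk : forall z, z <> z0 -> Cdiff (fun z => / (z - z0))%C z).
  { intros z Hz. apply (Cdiff_inv (fun z => z - z0)%C).
    - apply Cdiff_minus; [apply Cdiff_id|apply Cdiff_const].
    - now apply Csub_neq_0. }
  assert (H0 : rect_integral (fun z => (f z - f z0) * / (z - z0))%C a b c d = 0).
  { destruct (Hd x0 y0) as [l Hl]; try lra. 
    destruct (proj1 (is_derive_C_eps f z0 l) Hl 1) as [e [He H]]; [lra|].
    apply (goursat_removable _ a b c d x0 y0 (Cmod l + 1) e); auto.
    - intros x y H1 H2 H3. apply Cdiff_mult.
      + apply Cdiff_minus; [now apply Hd|apply Cdiff_const].
      + apply Hk. now apply pair_neq.
    - intros z Hz Hz'. fold z0 in Hz, Hz'. specialize (H z Hz').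
      assert (Hp : 0 < Cmod (z - z0)) by now apply Cmod_gt_0, Csub_neq_0.
      replace ((f z - f z0) * / (z - z0))%C with ((f z - f z0) / (z - z0))%C by reflexivity.
      rewrite Cmod_div by now apply Csub_neq_0. apply Rle_div_l; auto.
      replace (f z - f z0)%C with (f z - f z0 - l * (z - z0) + l * (z - z0))%C by ring.
      eapply Rle_trans; [apply Cmod_triangle|]. rewrite Cmod_mult. lra. }
  assert (Hbd : forall g, (forall x y, a <= x <= b -> c <= y <= d -> x <> x0 \/ y <> y0 -> Cdiff g (x, y)) ->
     on_boundary (Ccont g) a b c d).
  { intros g Hg. split; intros; split; apply Cdiff_Ccont, Hg; lra. }
  rewrite <- (rect_integral_scal (f z0) (fun z => / (z - z0))%C); try lra.
  2:{ apply Hbd. intros. apply Hk. now apply pair_neq. }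
  rewrite (rect_integral_ext _ (fun z => (f z - f z0) * / (z - z0) + f z0 * / (z - z0))%C); try lra.
  2:{ split; intros; split; ring. }
  rewrite (rect_integral_plus (fun z => (f z - f z0) * / (z - z0))%C (fun z => f z0 * / (z - z0))%C), H0; try lra.
  - ring.
  - apply Hbd. intros. apply Cdiff_mult; [|apply Hk; now apply pair_neq].
    apply Cdiff_minus; [now apply Hd|apply Cdiff_const].
  - apply Hbd. intros. apply Cdiff_mult; [apply Cdiff_const|apply Hk; now apply pair_neq].
Qed.

Lemma snd_rect_integral h a b c d : snd (rect_integral h a b c d) =
  RInt (fun x => snd (h (x, c))) a b + RInt (fun y => fst (h (b, y))) c d
  - RInt (fun x => snd (h (x, d))) a b - RInt (fun y => fst (h (a, y))) c d.
Proof. unfold rect_integral, IntC; simpl. ring. Qed.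

(** The value is 2 pi i, but a crude bound suffices. On each side of the centred square the oriented
    contribution to the imaginary part is the integral of r / (t^2 + r^2) >= 1 / (2 r) over a length
    2 r, hence at least 1; the four sides give at least 4. *)
Lemma rect_integral_kernel_neq_0 x0 y0 r : 0 < r ->
  rect_integral (fun z => / (z - (x0, y0)))%C (x0 - r) (x0 + r) (y0 - r) (y0 + r) <> 0.
Proof.
  intros Hr.
  set (h := fun z => (/ (z - (x0, y0)))%C).
  assert (Hk : forall x y, x <> x0 \/ y <> y0 -> Ccont h (x, y)).
  { intros x y Hz. apply Cdiff_Ccont, (Cdiff_inv (fun z => z - (x0, y0))%C).
    - apply Cdiff_minus; [apply Cdiff_id|apply Cdiff_const].
    - now apply Csub_neq_0, pair_neq. }
  assert (Hbd : on_boundary (Ccont h) (x0 - r) (x0 + r) (y0 - r) (y0 + r)).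
  { split; intros; split; apply Hk; lra. }
  destruct (on_boundary_Rcont _ _ _ _ _ Hbd) as [C1 [C2 [C3 C4]]].
  apply Rcont_ex in C1; [|lra]. apply Rcont_ex in C2; [|lra].
  apply Rcont_ex in C3; [|lra]. apply Rcont_ex in C4; [|lra].
  assert (Hq : forall t, t ^ 2 <= r ^ 2 -> / (2 * r) <= r / (t ^ 2 + r ^ 2)).
  { intros t Ht. apply Rle_div_r; [nra|].
    replace r with (/ (2 * r) * (2 * r ^ 2)) at 3 by (field; lra).
    apply Rmult_le_compat_l; [left; apply Rinv_0_lt_compat; lra|lra]. }
  assert (Hc : forall u, RInt (fun _ => / (2 * r)) (u - r) (u + r) = 1).
  { intros u. rewrite RInt_const. unfold scal; simpl; unfold mult; simpl. field; lra. }
  assert (Hex : forall u v : R, ex_RInt (fun _ => / (2 * r)) u v) by (intros; apply ex_RInt_const).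
  assert (Hlow : forall g u, ex_RInt g (u - r) (u + r) -> 
     (forall t, u - r < t < u + r -> g t = r / ((t - u) ^ 2 + r ^ 2)) -> 1 <= RInt g (u - r) (u + r)).
  { intros g u Hg Ht. rewrite <- (Hc u). apply RInt_le; auto; [lra|].
    intros t Htt. rewrite Ht by lra. apply Hq. nra. }
  assert (Hup : forall g u, ex_RInt g (u - r) (u + r) -> 
     (forall t, u - r < t < u + r -> g t = - (r / ((t - u) ^ 2 + r ^ 2))) -> RInt g (u - r) (u + r) <= - 1).
  { intros g u Hg Ht.
    assert (1 <= RInt (fun t => - g t) (u - r) (u + r)).
    { apply Hlow; [now apply (ex_RInt_opp (V := R_NormedModule) g)|]. intros t Htt. rewrite (Ht t Htt). apply Ropp_involutive. }
    rewrite (RInt_opp (V := R_CompleteNormedModule) g) in H by auto. unfold opp in H; simpl in H. lra. }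
  assert (I1 := Hlow (fun t => snd (h (t, y0 - r))) x0 (proj2 C1)).
  assert (I2 := Hup (fun t => snd (h (t, y0 + r))) x0 (proj2 C2)).
  assert (I3 := Hup (fun t => fst (h (x0 - r, t))) y0 (proj1 C3)).
  assert (I4 := Hlow (fun t => fst (h (x0 + r, t))) y0 (proj1 C4)).
  assert (Hpos : forall t, 0 < t ^ 2 + r ^ 2) by (intros; nra).
  intros E. apply (f_equal snd) in E. fold h in E. rewrite snd_rect_integral in E. simpl (snd (RtoC 0)) in E.
  enough (4 <= 0) by lra.
  rewrite <- E.
  match type of I1 with ?A -> _ => assert (G1 : A) end.
  { intros t _. unfold h, Cinv, Cminus, Cplus, Copp; simpl. field. specialize (Hpos (t - x0)). repeat split; nra. }
  match type of I2 with ?A -> _ => assert (G2 : A) end.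
  { intros t _. unfold h, Cinv, Cminus, Cplus, Copp; simpl. field. specialize (Hpos (t - x0)). repeat split; nra. }
  match type of I3 with ?A -> _ => assert (G3 : A) end.
  { intros t _. unfold h, Cinv, Cminus, Cplus, Copp; simpl. field. specialize (Hpos (t - y0)). repeat split; nra. }
  match type of I4 with ?A -> _ => assert (G4 : A) end.
  { intros t _. unfold h, Cinv, Cminus, Cplus, Copp; simpl. field. specialize (Hpos (t - y0)). repeat split; nra. }
  specialize (I1 G1). specialize (I2 G2). specialize (I3 G3). specialize (I4 G4).
  lra.
Qed.

Lemma on_boundary_impl (Q Q' : C -> Prop) a b c d : a <= b -> c <= d ->
  (forall x y, a <= x <= b -> c <= y <= d -> (x = a \/ x = b \/ y = c \/ y = d) -> Q (x, y) -> Q' (x, y)) ->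
  on_boundary Q a b c d -> on_boundary Q' a b c d.
Proof.
  intros Hab Hcd H [H1 H2].
  split; intros t Ht; split; apply H; auto; try lra; try apply H1; try apply H2; auto.
Qed.

Ltac Cdiff_auto :=
  repeat match goal with
  | |- Cdiff (fun z => @?f z + @?g z)%C _ => apply (Cdiff_plus f g)
  | |- Cdiff (fun z => @?f z * @?g z)%C _ => apply (Cdiff_mult f g)
  | |- Cdiff (fun z => ?k) _ => apply (Cdiff_const k)
  | |- _ => assumption
  end.

(** Finite geometric expansion of the Cauchy kernel: with u = 1 / (z - z0) and v = 1 / (z - z0 - w)
    one has v = u + w u^2 + w^2 u^3 + w^3 u^3 v. On the boundary |u| <= 1 / r and |v| <= 2 / r, so
    the last term integrates to O(|w|^3). Only boundary values of [F] enter, so the same statement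
    serves for the function and for the constant 1. *)
Lemma cauchy_expansion F x0 y0 r M : 0 < r ->
  on_boundary (Cdiff F) (x0 - r) (x0 + r) (y0 - r) (y0 + r) ->
  on_boundary (fun z => Cmod (F z) <= M) (x0 - r) (x0 + r) (y0 - r) (y0 + r) ->
  exists k1 k2 N, forall w, Cmod w <= r / 2 ->
    Cmod (rect_integral (fun z => F z * / (z - ((x0, y0) + w)))%C (x0 - r) (x0 + r) (y0 - r) (y0 + r)
      - (rect_integral (fun z => F z * / (z - (x0, y0)))%C (x0 - r) (x0 + r) (y0 - r) (y0 + r) + k1 * w + k2 * (w * w)))
     <= N * Cmod w ^ 3.
Proof.
  intros Hr HF HM.
  set (a := x0 - r) in *. set (b := x0 + r) in *. set (c := y0 - r) in *. set (d := y0 + r) in *.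
  set (z0 := (x0, y0) : C).
  assert (Hab : a <= b) by (unfold a, b; lra). assert (Hcd : c <= d) by (unfold c, d; lra).
  set (u := fun z => (/ (z - z0))%C).
  exists (rect_integral (fun z => F z * u z * u z)%C a b c d), (rect_integral (fun z => F z * u z * u z * u z)%C a b c d),
    (2 * ((b - a) + (d - c)) * (M * / r * / r * / r * (/ (r / 2)))).
  intros w Hw.
  set (v := fun z => (/ (z - (z0 + w)))%C).
  assert (HD : on_boundary (fun z => r <= Cmod (z - z0)) a b c d).
  { apply (on_boundary_impl (fun _ => True)); auto; [|split; auto].
    intros x y Hx Hy Hor _. assert (K := Rmax_Cmod ((x, y) - z0)%C). simpl in K.
    destruct Hor as [E|[E|[E|E]]].
    - eapply Rle_trans; [|eapply Rle_trans; [apply Rmax_l|exact K]]. rewrite E. unfold a.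
      rewrite <- Rabs_Ropp, Rabs_pos_eq; lra.
    - eapply Rle_trans; [|eapply Rle_trans; [apply Rmax_l|exact K]]. rewrite E. unfold b.
      rewrite Rabs_pos_eq; lra.
    - eapply Rle_trans; [|eapply Rle_trans; [apply Rmax_r|exact K]]. rewrite E. unfold c.
      rewrite <- Rabs_Ropp, Rabs_pos_eq; lra.
    - eapply Rle_trans; [|eapply Rle_trans; [apply Rmax_r|exact K]]. rewrite E. unfold d.
      rewrite Rabs_pos_eq; lra. }
  assert (Hz : forall z, r <= Cmod (z - z0) -> (z - z0)%C <> 0 /\ r / 2 <= Cmod (z - (z0 + w))
     /\ (z - (z0 + w))%C <> 0).
  { intros z H. assert (r / 2 <= Cmod (z - (z0 + w))).
    { assert (Cmod (z - z0) <= Cmod (z - (z0 + w)) + Cmod w).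
      { replace (z - z0)%C with (z - (z0 + w) + w)%C by ring. apply Cmod_triangle. } lra. }
    repeat split; auto; apply Cmod_gt_0; lra. }
  assert (Hall : on_boundary (fun z => Cdiff F z /\ Cmod (F z) <= M /\ r <= Cmod (z - z0)) a b c d).
  { destruct HF as [A1 A2], HM as [B1 B2], HD as [C1 C2].
    split; intros t Ht.
    - destruct (A1 t Ht), (B1 t Ht), (C1 t Ht); auto.
    - destruct (A2 t Ht), (B2 t Ht), (C2 t Ht); auto. }
  assert (Hdu : forall z, r <= Cmod (z - z0) -> Cdiff u z).
  { intros z H. apply (Cdiff_inv (fun z => z - z0)%C); [|now apply Hz].
    apply Cdiff_minus; [apply Cdiff_id|apply Cdiff_const]. }
  assert (Hdv : forall z, r <= Cmod (z - z0) -> Cdiff v z).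
  { intros z H. apply (Cdiff_inv (fun z => z - (z0 + w))%C); [|now apply Hz].
    apply Cdiff_minus; [apply Cdiff_id|apply Cdiff_const]. }
  assert (Hc : forall g, (forall z, Cdiff F z -> Cdiff u z -> Cdiff v z -> Cdiff g z) -> on_boundary (Ccont g) a b c d).
  { intros g Hg. revert Hall. apply on_boundary_impl; auto. intros x y _ _ _ [H1 [H2 H3]].
    apply Cdiff_Ccont, Hg; auto. }
  assert (Hbu : forall z, r <= Cmod (z - z0) -> Cmod (u z) <= / r).
  { intros z H. unfold u. rewrite Cmod_inv by now apply Hz. now apply Rinv_le_contravar. }
  assert (Hbv : forall z, r <= Cmod (z - z0) -> Cmod (v z) <= / (r / 2)).
  { intros z H. unfold v. rewrite Cmod_inv by now apply Hz. apply Rinv_le_contravar; [lra|now apply Hz]. }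
  assert (Huv : forall z, r <= Cmod (z - z0) ->
    (v z = u z + w * (u z * u z) + w * w * (u z * u z * u z) + w * w * w * (u z * u z * u z * v z))%C).
  { intros z H. destruct (Hz z H) as [Z1 [_ Z3]]. unfold u, v. field. auto. }
  change (fun z => F z * / (z - (z0 + w)))%C with (fun z => F z * v z)%C.
  change (fun z => F z * / (z - z0))%C with (fun z => F z * u z)%C.
  (* From here [u] and [v] are atoms for [ring] and [Cdiff_auto]; [Huv] and the bounds carry all
     that is needed about them. *)
  clearbody u v.
  set (Rem := rect_integral (fun z => F z * u z * u z * u z * v z)%C a b c d).
  assert (E : rect_integral (fun z => F z * v z)%C a b c d =
    (rect_integral (fun z => F z * u z)%C a b c d + (w * rect_integral (fun z => F z * u z * u z)%C a b c d +
      (w * w * rect_integral (fun z => F z * u z * u z * u z)%C a b c d + w * w * w * Rem)))%C).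
  { rewrite (rect_integral_ext _ (fun z => F z * u z + (w * (F z * u z * u z) + (w * w * (F z * u z * u z * u z) +
       w * w * w * (F z * u z * u z * u z * v z))))%C); auto.
    2:{ revert Hall. apply on_boundary_impl; auto. intros x y _ _ _ [H1 [H2 H3]].
        rewrite (Huv (x, y) H3) at 1. ring. }
    set (g0 := fun z => (F z * u z)%C). set (g1 := fun z => (F z * u z * u z)%C).
    set (g2 := fun z => (F z * u z * u z * u z)%C). set (g3 := fun z => (F z * u z * u z * u z * v z)%C).
    assert (C0 : on_boundary (Ccont g0) a b c d) by (apply Hc; intros; unfold g0; Cdiff_auto).
    assert (C1 : on_boundary (Ccont g1) a b c d) by (apply Hc; intros; unfold g1; Cdiff_auto).
    assert (C2 : on_boundary (Ccont g2) a b c d) by (apply Hc; intros; unfold g2; Cdiff_auto).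
    assert (C3 : on_boundary (Ccont g3) a b c d) by (apply Hc; intros; unfold g3; Cdiff_auto).
    assert (C1' : on_boundary (Ccont (fun z => w * g1 z)%C) a b c d) by (apply Hc; intros; unfold g1; Cdiff_auto).
    assert (C2' : on_boundary (Ccont (fun z => w * w * g2 z)%C) a b c d) by (apply Hc; intros; unfold g2; Cdiff_auto).
    assert (C3' : on_boundary (Ccont (fun z => w * w * w * g3 z)%C) a b c d) by (apply Hc; intros; unfold g3; Cdiff_auto).
    assert (C23 : on_boundary (Ccont (fun z => w * w * g2 z + w * w * w * g3 z)%C) a b c d)
      by (apply Hc; intros; unfold g2, g3; Cdiff_auto).
    assert (C123 : on_boundary (Ccont (fun z => w * g1 z + (w * w * g2 z + w * w * w * g3 z))%C) a b c d)
      by (apply Hc; intros; unfold g1, g2, g3; Cdiff_auto).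
    unfold Rem. fold g3.
    rewrite <- (rect_integral_scal w g1), <- (rect_integral_scal (w * w) g2), <- (rect_integral_scal (w * w * w) g3) by assumption.
    rewrite <- !rect_integral_plus by assumption. reflexivity. }
  rewrite E.
  match goal with |- Cmod ?X <= _ => replace X with (w * w * w * Rem)%C by ring end.
  rewrite !Cmod_mult.
  replace (Cmod w ^ 3) with (Cmod w * Cmod w * Cmod w) by ring.
  rewrite Rmult_comm. apply Rmult_le_compat_r.
  { assert (0 <= Cmod w) by apply Cmod_ge_0. nra. }
  unfold Rem. apply rect_integral_bound; auto.
  { apply Hc; intros z H1 H2 H3; 
     Cdiff_auto. }
  revert Hall. apply on_boundary_impl; auto. intros x y _ _ _ [H1 [H2 H3]].
  rewrite !Cmod_mult.
  assert (K := Cmod_ge_0). specialize (Hbu _ H3). specialize (Hbv _ H3).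
  repeat (apply Rmult_le_compat; auto; repeat apply Rmult_le_pos; auto).
Qed.

Lemma cont_bounded f z : Ccont f z -> exists e, 0 < e /\ forall y, Cmod (y - z) < e -> Cmod (f y) <= Cmod (f z) + 1.
Proof.
  intros H. destruct (proj1 (Ccont_eps f z) H 1) as [e [He H']]; [lra|].
  exists e; split; auto. intros y Hy. specialize (H' y Hy).
  replace (f y) with (f y - f z + f z)%C by ring.
  eapply Rle_trans; [apply Cmod_triangle|]. lra.
Qed.

(* The kernel integral need not be computed: it is expanded as well, and the
   Taylor coefficients are obtained by dividing the two expansions. *)
Lemma taylor2 f z0 e : 0 < e -> (forall z, Cmod (z - z0) < e -> Cdiff f z) ->
  exists a1 a2 N r, 0 < r /\ 0 <= N /\ forall w, Cmod w < r ->
    Cmod (f (z0 + w)%C - (f z0 + a1 * w + a2 * (w * w))) <= N * Cmod w ^ 3.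
Proof.
  intros He Hd.
  destruct (cont_bounded f z0) as [e1 [He1 HM]].
  { apply Cdiff_Ccont, Hd. replace (z0 - z0)%C with (RtoC 0) by ring. rewrite Cmod_0; lra. }
  set (M := Cmod (f z0) + 1) in *. assert (HM0 : 0 <= M) by (unfold M; assert (H := Cmod_ge_0 (f z0)); lra).
  destruct z0 as [x0 y0].
  (* Points of the square are at distance at most 2 r from its centre, so the square lies in both
     discs. *)
  set (r := Rmin e e1 / 3).
  assert (Hr : 0 < r) by (unfold r; assert (0 < Rmin e e1) by (now apply Rmin_pos); lra).
  assert (Hre : 3 * r <= e) by (unfold r; assert (H := Rmin_l e e1); lra).
  assert (Hre1 : 3 * r <= e1) by (unfold r; assert (H := Rmin_r e e1); lra).
  set (a := x0 - r). set (b := x0 + r). set (c := y0 - r). set (d := y0 + r).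
  assert (Hab : a <= b) by (unfold a, b; lra). assert (Hcd : c <= d) by (unfold c, d; lra).
  assert (HB : forall x y, a <= x <= b -> c <= y <= d -> Cmod ((x, y) - (x0, y0)) < 3 * r).
  { intros x y Hx Hy. unfold a, b, c, d in *.
    eapply Rle_lt_trans; [apply (Cmod_le_1 (x - x0) (y - y0))|].
    assert (Rabs (x - x0) <= r) by (apply Rabs_le; lra). assert (Rabs (y - y0) <= r) by (apply Rabs_le; lra). lra. }
  assert (HfD : forall x y, a <= x <= b -> c <= y <= d -> Cdiff f (x, y)).
  { intros x y Hx Hy. apply Hd. specialize (HB x y Hx Hy). lra. }
  destruct (cauchy_expansion f x0 y0 r M Hr) as [k1 [k2 [N1 K]]].
  { split; intros; split; apply HfD; unfold a, b, c, d; lra. }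
  { assert (forall x y, a <= x <= b -> c <= y <= d -> Cmod (f (x, y)) <= M).
    { intros x y Hx Hy. apply HM. specialize (HB x y Hx Hy). lra. }
    split; intros; split; apply H; unfold a, b, c, d; lra. }
  destruct (cauchy_expansion (fun _ => RtoC 1) x0 y0 r 1 Hr) as [c1 [c2 [N2 L]]].
  { split; intros; split; apply Cdiff_const. }
  { split; intros; split; rewrite Cmod_1; lra. }
  fold a b c d in K, L.
  assert (Hone : forall z, rect_integral (fun z0 => 1 * / (z0 - z))%C a b c d = rect_integral (fun z0 => / (z0 - z))%C a b c d).
  { intros z. apply rect_integral_ext; auto. split; intros; split; ring. }
  assert (Hc0 : rect_integral (fun z => / (z - (x0, y0)))%C a b c d <> 0) by (now apply rect_integral_kernel_neq_0).
  rewrite Hone in L.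
  set (c0 := rect_integral (fun z => / (z - (x0, y0)))%C a b c d) in *.
  rewrite cauchy_rectangle in K by (auto; unfold a, b, c, d; lra).
  fold c0 in K. set (z0 := (x0, y0) : C) in *.
  assert (F : forall w, Cmod w < r -> 
    rect_integral (fun z => f z * / (z - (z0 + w)))%C a b c d = (f (z0 + w)%C * rect_integral (fun z => 1 * / (z - (z0 + w)))%C a b c d)%C).
  { intros [p q] Hw. rewrite Hone.
    assert (H := Rmax_Cmod (p, q)). simpl in H.
    assert (H1 := Rle_trans _ _ _ (Rmax_l _ _) H). assert (H2 := Rle_trans _ _ _ (Rmax_r _ _) H).
    apply Rabs_le_between in H1. apply Rabs_le_between in H2.
    apply (cauchy_rectangle f a b c d (x0 + p) (y0 + q)); auto; unfold a, b, c, d; lra. }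
  set (a1 := ((k1 - f z0 * c1) / c0)%C). set (a2 := ((k2 - f z0 * c2 - a1 * c1) / c0)%C).
  exists a1, a2.
  (* The errors of [E1] in order: expansion of the numerator, expansion of the kernel integral, and
     the terms of degree 3 and 4 in the product of the truncated polynomials; |w| < 1 absorbs degree
     4 into degree 3. *)
  set (q := (Rabs N1 + M * Rabs N2) + Cmod (a1 * c2 + a2 * c1) + Cmod (a2 * c2)).
  assert (Hq : 0 <= q).
  { unfold q. assert (A1 := Rabs_pos N1). assert (A2 := Rabs_pos N2).
    assert (A3 := Cmod_ge_0 (a1 * c2 + a2 * c1)). assert (A4 := Cmod_ge_0 (a2 * c2)). nra. }
  assert (Hc0p : 0 < Cmod c0) by now apply Cmod_gt_0.
  set (s := Cmod c1 + Cmod c2 + 1).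
  assert (Hs : 1 <= s) by (unfold s; assert (A1 := Cmod_ge_0 c1); assert (A2 := Cmod_ge_0 c2); lra).
  (* The last radius keeps the truncated denominator [cw] above |c0| / 2 in modulus, so that
     dividing by it is harmless. *)
  exists (q / (Cmod c0 / 2)), (Rmin 1 (Rmin (r / 2) (Cmod c0 / 2 / s))).
  split; [|split].
  { repeat apply Rmin_pos; try lra. apply Rdiv_lt_0_compat; lra. }
  { apply Rdiv_le_0_compat; lra. }
  intros w Hw.
  assert (W1 : Cmod w < 1) by (eapply Rlt_le_trans; [apply Hw|apply Rmin_l]).
  assert (W2 : Cmod w < r / 2) by (eapply Rlt_le_trans; [apply Hw|]; eapply Rle_trans; [apply Rmin_r|apply Rmin_l]).
  assert (W3 : Cmod w < Cmod c0 / 2 / s) by (eapply Rlt_le_trans; [apply Hw|]; eapply Rle_trans; [apply Rmin_r|apply Rmin_r]).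
  specialize (K w (Rlt_le _ _ W2)). specialize (L w (Rlt_le _ _ W2)).
  rewrite F in K by lra.
  set (kw := rect_integral (fun z => 1 * / (z - (z0 + w)))%C a b c d) in *.
  set (fw := f (z0 + w)%C) in *.
  assert (Hfw : Cmod fw <= M).
  { apply HM. replace (z0 + w - z0)%C with w by ring. lra. }
  set (A := (f z0 + a1 * w + a2 * (w * w))%C).
  set (cw := (c0 + c1 * w + c2 * (w * w))%C).
  assert (P := Cmod_ge_0 w).
  assert (E1 : ((fw - A) * cw)%C =
     ((fw * kw - (f z0 * c0 + k1 * w + k2 * (w * w))) + - (fw * (kw - cw)) + 
      - ((a1 * c2 + a2 * c1) * (w * w * w)) + - ((a2 * c2) * (w * w * w * w)))%C).
  { unfold A, cw, a2, a1. field. auto. }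
  assert (B1 : Cmod ((fw - A) * cw) <= q * Cmod w ^ 3).
  { rewrite E1. eapply Rle_trans; [apply Cmod_triangle|].
    eapply Rle_trans; [apply Rplus_le_compat_r, Cmod_triangle|].
    eapply Rle_trans; [apply Rplus_le_compat_r, Rplus_le_compat_r, Cmod_triangle|].
    rewrite !Cmod_opp, (Cmod_mult fw), (Cmod_mult (_ + _)), (Cmod_mult (a2 * c2)), !(Cmod_mult _ w).
    assert (P3 : 0 <= Cmod w ^ 3) by now apply pow_le.
    assert (T1 : Cmod (fw * kw - (f z0 * c0 + k1 * w + k2 * (w * w))) <= Rabs N1 * Cmod w ^ 3).
    { eapply Rle_trans; [apply K|]. apply Rmult_le_compat_r; [auto|apply Rle_abs]. }
    assert (T2 : Cmod fw * Cmod (kw - cw) <= M * (Rabs N2 * Cmod w ^ 3)).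
    { apply Rmult_le_compat; auto using Cmod_ge_0.
      eapply Rle_trans; [apply L|]. apply Rmult_le_compat_r; [auto|apply Rle_abs]. }
    assert (T4 : Cmod (a2 * c2) * (Cmod w * Cmod w * Cmod w * Cmod w) <= Cmod (a2 * c2) * (Cmod w ^ 3)).
    { apply Rmult_le_compat_l; [apply Cmod_ge_0|]. 
      replace (Cmod w * Cmod w * Cmod w * Cmod w) with (Cmod w ^ 3 * Cmod w) by ring.
      rewrite <- (Rmult_1_r (Cmod w ^ 3)) at 2. apply Rmult_le_compat_l; lra. }
    unfold q. lra. }
  assert (B2 : Cmod c0 / 2 <= Cmod cw).
  { assert (Cmod c0 <= Cmod cw + Cmod (c1 * w + c2 * (w * w))).
    { replace c0 with (cw + - (c1 * w + c2 * (w * w)))%C by (unfold cw; ring).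
      rewrite <- (Cmod_opp (c1 * w + c2 * (w * w))). 
      eapply Rle_trans; [apply Cmod_triangle|]. lra. }
    assert (Cmod (c1 * w + c2 * (w * w)) <= s * Cmod w).
    { eapply Rle_trans; [apply Cmod_triangle|]. rewrite !Cmod_mult. unfold s.
      assert (Cmod c2 * (Cmod w * Cmod w) <= Cmod c2 * Cmod w).
      { apply Rmult_le_compat_l; [apply Cmod_ge_0|]. nra. }
      lra. }
    assert (s * Cmod w <= Cmod c0 / 2).
    { apply Rlt_le in W3. apply Rle_div_r in W3; lra. }
    lra. }
  rewrite Cmod_mult in B1.
  replace (q / (Cmod c0 / 2) * Cmod w ^ 3) with (q * Cmod w ^ 3 / (Cmod c0 / 2)) by (field; lra).
  apply Rle_div_r; [lra|].
  eapply Rle_trans; [|apply B1]. apply Rmult_le_compat_l; [apply Cmod_ge_0|lra].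
Qed.

(** * Probability generating functions *)

Definition pgf_sum (p : nat -> R) (z : C) (n : nat) : C :=
  sum_n (G := C_AbelianGroup) (fun k => (z ^ k * RtoC (p k))%C) n.

Lemma pow_n_Cpow (z : C) k : pow_n (K := C_Ring) z k = (z ^ k)%C.
Proof. induction k; simpl; [reflexivity|]. rewrite IHk. reflexivity. Qed.

Lemma is_pseries_pgf_sum p z l :
  is_pseries (K := C_AbsRing) (V := C_NormedModule) (fun n => RtoC (p n)) z l ->
  forall eps, 0 < eps -> exists N, forall n, (N <= n)%nat -> Cmod (pgf_sum p z n - l) < eps.
Proof.
  intros H eps Heps.
  assert (L : locally (T := C_UniformSpace) l (fun y => Cmod (y - l) < eps))
    by (apply locally_Cmod; exists eps; auto).
  apply H in L. destruct L as [N HN]. exists N. intros n Hn. specialize (HN n Hn).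
  unfold pgf_sum. erewrite sum_n_ext; [exact HN|]. intros k; simpl. rewrite <- pow_n_Cpow. reflexivity.
Qed.

Lemma sum_pgf_le p : is_pgf p -> forall n, sum_n p n <= 1.
Proof.
  intros [Hp Hs] n. 
  apply (is_lim_seq_incr_compare (sum_n p) 1).
  - exact Hs.
  - intros k. rewrite sum_Sn. specialize (Hp (S k)). unfold plus; simpl. lra.
Qed.

Lemma pgf_sum_S p z n : pgf_sum p z (S n) = (pgf_sum p z n + z ^ S n * RtoC (p (S n)))%C.
Proof. unfold pgf_sum. rewrite sum_Sn. reflexivity. Qed.

(** On the closed disc |z|^k <= |z|^2 for every k >= 2, and the constant term vanishes. The index
    [S n] guarantees that the linear term is present. *)
Lemma pgf_sum_bound p z : is_pgf p -> p O = 0 -> Cmod z <= 1 -> forall n, 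
  Cmod (pgf_sum p z (S n) - RtoC (p 1%nat) * z) <= (sum_n p (S n) - p 1%nat) * Cmod z ^ 2.
Proof.
  intros [Hp _] H0 Hz n. assert (P := Cmod_ge_0 z). induction n.
  - rewrite pgf_sum_S, sum_Sn. unfold pgf_sum. rewrite !sum_O. unfold plus; simpl. rewrite H0.
    match goal with |- Cmod ?X <= _ => replace X with (RtoC 0) by ring end.
    rewrite Cmod_0. lra.
  - rewrite pgf_sum_S, sum_Sn. 
    replace (pgf_sum p z (S n) + z ^ S (S n) * p (S (S n)) - p 1%nat * z)%C with
     ((pgf_sum p z (S n) - p 1%nat * z) + z ^ S (S n) * p (S (S n)))%C by ring.
    eapply Rle_trans; [apply Cmod_triangle|].
    rewrite Cmod_mult, Cmod_pow, Cmod_R, (Rabs_pos_eq (p _)) by apply Hp.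
    change (plus (sum_n p (S n)) (p (S (S n)))) with (sum_n p (S n) + p (S (S n))).
    assert (Cmod z ^ S (S n) <= Cmod z ^ 2).
    { change (S (S n)) with (2 + n)%nat. rewrite pow_add.
      rewrite <- (Rmult_1_r (Cmod z ^ 2)) at 2. apply Rmult_le_compat_l; [apply pow_le; auto|].
      rewrite <- (pow1 n). apply pow_incr; lra. }
    specialize (Hp (S (S n))).
    nra.
Qed.

Lemma pgf_sum_real p (x : R) n : snd (pgf_sum p x n) = 0.
Proof.
  induction n.
  - unfold pgf_sum. rewrite sum_O. simpl. ring.
  - rewrite pgf_sum_S, <- RtoC_pow, <- RtoC_mult.
    change (snd (pgf_sum p x n) + 0 = 0). rewrite IHn. ring.
Qed.

Lemma pgf_sum_1 p n : pgf_sum p 1 n = RtoC (sum_n p n).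
Proof.
  induction n.
  - unfold pgf_sum. rewrite !sum_O. simpl. ring.
  - rewrite pgf_sum_S, sum_Sn, IHn, Cpow_1_l. unfold plus; simpl. rewrite RtoC_plus. ring.
Qed.

Lemma pgf_sum_0 p n : pgf_sum p 0 n = RtoC (p O).
Proof.
  induction n.
  - unfold pgf_sum. rewrite !sum_O. simpl. ring.
  - rewrite pgf_sum_S, IHn. rewrite Cpow_S. ring.
Qed.

Section Facts.
Variables (p : nat -> R) (D : C -> Prop) (P : C -> C) (d : R).
Hypothesis hp : is_pgf p.
Hypothesis hD : forall z : C, Cmod z <= 1 -> D z.
Hypothesis hP : hol_extension p D P.

Lemma pgf_sum_lim z : Cmod z <= 1 -> forall eps, 0 < eps ->
  exists N, forall n, (N <= n)%nat -> Cmod (pgf_sum p z n - P z) < eps.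
Proof. intros Hz. apply is_pseries_pgf_sum, hP; auto. Qed.

Lemma Cmod_small z : (forall eps, 0 < eps -> Cmod z < eps) -> z = 0.
Proof.
  intros H. apply Cmod_eq_0, Rle_antisym; [|apply Cmod_ge_0].
  apply Rnot_lt_le; intros K. specialize (H _ K). lra.
Qed.

Lemma pgf_at_1 : P 1 = 1.
Proof.
  replace (P 1) with (P 1 - 1 + 1)%C by ring. rewrite (Cmod_small (P 1 - 1)); [ring|].
  intros eps Heps.
  destruct (pgf_sum_lim 1) with (eps := eps / 2) as [N HN]; [rewrite Cmod_1; lra|lra|].
  assert (Hs := proj2 hp). apply is_series_Reals in Hs.
  destruct (Hs (eps / 2)) as [N' HN']; [lra|].
  set (n := Nat.max N N').
  specialize (HN n (Nat.le_max_l _ _)). specialize (HN' n (Nat.le_max_r _ _)).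
  rewrite pgf_sum_1 in HN. rewrite <- sum_n_Reals in HN'. unfold Rdist in HN'.
  replace (P 1 - 1)%C with (- (RtoC (sum_n p n) - P 1) + RtoC (sum_n p n - 1))%C by (rewrite RtoC_minus; ring).
  eapply Rle_lt_trans; [apply Cmod_triangle|]. rewrite Cmod_opp, Cmod_R. lra.
Qed.

Lemma pgf_at_0 : P 0 = RtoC (p O).
Proof.
  replace (P 0) with (P 0 - p O + p O)%C by ring. rewrite (Cmod_small (P 0 - p O)); [ring|].
  intros eps Heps.
  destruct (pgf_sum_lim 0) with (eps := eps) as [N HN]; [rewrite Cmod_0; lra|lra|].
  specialize (HN N (le_n N)). rewrite pgf_sum_0 in HN.
  rewrite <- Cmod_opp. replace (- (P 0 - p O))%C with (p O - P 0)%C by ring. exact HN.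
Qed.

Lemma pgf_real (x : R) : 0 <= x <= 1 -> snd (P x) = 0.
Proof.
  intros Hx. 
  enough (H : forall eps, 0 < eps -> Rabs (snd (P x)) < eps).
  { assert (K := Rabs_pos (snd (P x))). destruct (Req_dec (snd (P x)) 0) as [|Hn]; auto.
    specialize (H _ (Rabs_pos_lt _ Hn)). lra. }
  intros eps Heps.
  destruct (pgf_sum_lim x) with (eps := eps) as [N HN]; [rewrite Cmod_R, Rabs_pos_eq; lra|lra|].
  specialize (HN N (le_n N)).
  assert (K := Rle_trans _ _ _ (Rmax_r _ _) (Rmax_Cmod (pgf_sum p x N - P x)%C)).
  change (snd (pgf_sum p x N - P x)%C) with (snd (pgf_sum p x N) + - snd (P x)) in K.
  rewrite pgf_sum_real, Rplus_0_l, Rabs_Ropp in K. lra.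
Qed.

Hypothesis hP0 : P 0 = 0.

Lemma p0_eq0 : p O = 0.
Proof. assert (H := pgf_at_0). rewrite hP0 in H. now apply RtoC_inj in H. Qed.

Lemma pgf_quadratic_p1 z : Cmod z <= 1 -> Cmod (P z - RtoC (p 1%nat) * z) <= (1 - p 1%nat) * Cmod z ^ 2.
Proof.
  intros Hz. apply Rnot_lt_le. intros K.
  destruct (pgf_sum_lim z Hz) with (eps := Cmod (P z - RtoC (p 1%nat) * z) - (1 - p 1%nat) * Cmod z ^ 2) as [N HN]; [lra|].
  specialize (HN (S N) (Nat.le_succ_diag_r N)).
  assert (H1 := pgf_sum_bound p z hp p0_eq0 Hz N).
  assert (H2 := sum_pgf_le p hp (S N)).
  assert (H3 : 0 <= Cmod z ^ 2) by (apply pow_le, Cmod_ge_0).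
  assert (Cmod (P z - p 1%nat * z) <= Cmod (pgf_sum p z (S N) - P z) + Cmod (pgf_sum p z (S N) - p 1%nat * z)).
  { rewrite <- (Cmod_opp (_ - P z)).
    replace (P z - p 1%nat * z)%C with (- (pgf_sum p z (S N) - P z) + (pgf_sum p z (S N) - p 1%nat * z))%C by ring.
    apply Cmod_triangle. }
  nra.
Qed.

Hypothesis hd : C_derive P 0 = d.

(** The quadratic bound is itself a first-order expansion at 0, which replaces termwise
    differentiation. *)
Lemma p1_eq : p 1%nat = d.
Proof.
  apply RtoC_inj. rewrite <- hd. symmetry. apply is_C_derive_unique.
  apply is_derive_C_eps. intros eps Heps. exists (Rmin 1 eps). split; [apply Rmin_pos; lra|].
  intros y Hy. replace (y - 0)%C with y in * by ring.
  assert (H1 := Rlt_le_trans _ _ _ Hy (Rmin_l _ _)).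
  assert (H2 := Rlt_le_trans _ _ _ Hy (Rmin_r _ _)).
  rewrite hP0. replace (P y - 0 - p 1%nat * y)%C with (P y - p 1%nat * y)%C by ring.
  eapply Rle_trans; [apply pgf_quadratic_p1; lra|].
  assert (0 <= p 1%nat) by apply hp. assert (K := Cmod_ge_0 y). nra.
Qed.

(** From here on, the non-negativity of the coefficients enters only through this inequality. *)
Lemma pgf_quadratic z : Cmod z <= 1 -> Cmod (P z - RtoC d * z) <= (1 - d) * Cmod z ^ 2.
Proof. rewrite <- p1_eq. apply pgf_quadratic_p1. Qed.
End Facts.

(** * Expansion at 1 *)

(** The factor 1/2 makes the height agree to first order at 1 with the real part of z - 1. *)
Definition height (z : C) : R := (fst z ^ 2 + snd z ^ 2 - 1) / 2.

Lemma Cmod_sqr (z : C) : Cmod z ^ 2 = fst z ^ 2 + snd z ^ 2.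
Proof. apply Cmod2_alt. Qed.

Lemma height_neg z : height z < 0 <-> Cmod z < 1.
Proof.
  unfold height. rewrite <- Cmod_sqr. assert (H := Cmod_ge_0 z). split; intros; nra.
Qed.

Lemma height_shift v : height (1 + v) = fst v + Cmod v ^ 2 / 2.
Proof. rewrite Cmod_sqr. unfold height; simpl. field. Qed.

Lemma fst_le_Cmod z : Rabs (fst z) <= Cmod z.
Proof. eapply Rle_trans; [apply Rmax_l|apply Rmax_Cmod]. Qed.

Lemma snd_le_Cmod z : Rabs (snd z) <= Cmod z.
Proof. eapply Rle_trans; [apply Rmax_r|apply Rmax_Cmod]. Qed.

(** Divide by u and let u tend to 0. This is how signs of leading coefficients are read off from
    inequalities between expansions. *)
Lemma linear_le_quadratic A K r : 0 < r -> (forall u, 0 < u < r -> A * u <= K * u ^ 2) -> A <= 0.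
Proof.
  intros Hr H. apply Rnot_lt_le; intros HA.
  set (u := Rmin (r / 2) (A / (2 * (Rabs K + 1)))).
  assert (HK := Rabs_pos K). assert (HK' := Rle_abs K).
  assert (Hu : 0 < u) by (apply Rmin_pos; [lra|apply Rdiv_lt_0_compat; lra]).
  assert (Hu1 : u <= r / 2) by apply Rmin_l.
  assert (Hu2 : u * (2 * (Rabs K + 1)) <= A) by (apply Rle_div_r; [lra|apply Rmin_r]).
  specialize (H u). assert (A * u <= K * u ^ 2) by (apply H; lra). nra.
Qed.

(** Near the circle v is almost imaginary: v^2 = - |v|^2 + 2 v Re v, and Re v = h - |v|^2 / 2 with h
    the height of 1 + v. Hence Re (a2 v^2) equals - Re a2 |v|^2 up to |a2| |v| (2 |h| + |v|^2), and
    the quadratic part of the expansion depends on |v| alone. The terms m/2 and m^2/2 come from Re v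
    and from |m v|^2 / 2. *)
Lemma expansion_height (z v G a2 : C) m B N :
  0 <= m -> 0 <= N -> Cmod v <= 1 ->
  z = (1 + RtoC m * v + G)%C ->
  Cmod (G - a2 * (v * v)) <= N * Cmod v ^ 3 -> Cmod G <= B * Cmod v ^ 2 ->
  Rabs (height z - (m * height (1 + v) - (m / 2 + fst a2 - m ^ 2 / 2) * Cmod v ^ 2))
   <= 2 * Cmod a2 * Cmod v * Rabs (height (1 + v)) + (N + 2 * m * B + B ^ 2 + Cmod a2) * Cmod v ^ 3.
Proof.
  intros Hm HN Hv -> HE HG.
  set (s := Cmod v) in *. assert (Hs : 0 <= s) by apply Cmod_ge_0.
  assert (Es : s ^ 2 = fst v ^ 2 + snd v ^ 2) by apply Cmod_sqr.
  assert (F1 := Rle_trans _ _ _ (fst_le_Cmod _) HE).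
  assert (G1 := Rle_trans _ _ _ (fst_le_Cmod _) HG).
  assert (G2 := Rle_trans _ _ _ (snd_le_Cmod _) HG).
  assert (V1 : Rabs (fst v) <= s) by apply fst_le_Cmod.
  assert (V2 : Rabs (snd v) <= s) by apply snd_le_Cmod.
  assert (A1 : Rabs (fst (a2 * v)%C) <= Cmod a2 * s) by (unfold s; rewrite <- Cmod_mult; apply fst_le_Cmod).
  assert (Hh : height (1 + v) = fst v + s ^ 2 / 2) by apply height_shift.
  assert (HG2 : fst G ^ 2 + snd G ^ 2 <= B ^ 2 * s ^ 3).
  { rewrite <- Cmod_sqr. assert (Cmod G ^ 2 <= (B * s ^ 2) ^ 2) by (apply pow_incr; split; auto; apply Cmod_ge_0).
    assert (0 <= B ^ 2 * s ^ 3) by (apply Rmult_le_pos; [apply pow2_ge_0|now apply pow_le]).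
    replace ((B * s ^ 2) ^ 2) with (B ^ 2 * s ^ 3 * s) in H by ring.
    nra. }
  set (h := height (1 + v)) in *.
  assert (E : height (1 + m * v + G) - (m * h - (m / 2 + fst a2 - m ^ 2 / 2) * s ^ 2)
    = fst (G - a2 * (v * v))%C + 2 * (fst (a2 * v)%C * fst v) + m * (fst v * fst G) + m * (snd v * snd G)
       + (fst G ^ 2 + snd G ^ 2) / 2).
  { rewrite Hh, Es. unfold height; simpl. field. }
  rewrite E. 
  assert (B1 : Rabs (2 * (fst (a2 * v)%C * fst v)) <= 2 * (Cmod a2 * s * (Rabs h + s ^ 2 / 2))).
  { rewrite Rabs_mult, (Rabs_pos_eq 2), Rabs_mult by lra. apply Rmult_le_compat_l; [lra|].
    apply Rmult_le_compat; auto using Rabs_pos.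
    replace (fst v) with (h + - (s ^ 2 / 2)) by (rewrite Hh; ring).
    eapply Rle_trans; [apply Rabs_triang|]. rewrite Rabs_Ropp, (Rabs_pos_eq (s ^ 2 / 2)); [lra|].
    assert (0 <= s ^ 2) by now apply pow_le. lra. }
  assert (B2 : Rabs (m * (fst v * fst G)) <= m * (s * (B * s ^ 2))).
  { rewrite Rabs_mult, (Rabs_pos_eq m), Rabs_mult by lra. apply Rmult_le_compat_l; [lra|].
    apply Rmult_le_compat; auto using Rabs_pos. }
  assert (B3 : Rabs (m * (snd v * snd G)) <= m * (s * (B * s ^ 2))).
  { rewrite Rabs_mult, (Rabs_pos_eq m), Rabs_mult by lra. apply Rmult_le_compat_l; [lra|].
    apply Rmult_le_compat; auto using Rabs_pos. }
  assert (B4 : Rabs ((fst G ^ 2 + snd G ^ 2) / 2) <= B ^ 2 * s ^ 3).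
  { assert (0 <= fst G ^ 2 + snd G ^ 2) by (rewrite <- Cmod_sqr; apply pow2_ge_0).
    rewrite Rabs_pos_eq; lra. }
  eapply Rle_trans; [apply Rabs_triang|].
  eapply Rle_trans; [apply Rplus_le_compat_r, Rabs_triang|].
  eapply Rle_trans; [apply Rplus_le_compat_r, Rplus_le_compat_r, Rabs_triang|].
  eapply Rle_trans; [apply Rplus_le_compat_r, Rplus_le_compat_r, Rplus_le_compat_r, Rabs_triang|].
  replace ((N + 2 * m * B + B ^ 2 + Cmod a2) * s ^ 3) with
    (N * s ^ 3 + (m * (s * (B * s ^ 2)) + m * (s * (B * s ^ 2))) + B ^ 2 * s ^ 3 + Cmod a2 * s * s ^ 2) by ring.
  lra.
Qed.

Definition near1_expansion (P : C -> C) (m sigma B K r : R) : Prop :=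
  forall v, Cmod v < r ->
    Rabs (height (P (1 + v)%C) - (m * height (1 + v) - sigma * Cmod v ^ 2))
      <= B * Cmod v * Rabs (height (1 + v)) + K * Cmod v ^ 3 /\
    Cmod (P (1 + v)%C - 1 - RtoC m * v) <= B * Cmod v ^ 2.

Section Local.
Variables (P : C -> C) (d e : R).
Hypothesis hd : 0 < d < 1.
Hypothesis he : 0 < e.
Hypothesis hdiff : forall z, Cmod (z - 1) < e -> Cdiff P z.
Hypothesis h1 : P 1 = 1.
Hypothesis hreal : forall x : R, 0 <= x <= 1 -> snd (P x) = 0.
Hypothesis hquad : forall z, Cmod z <= 1 -> Cmod (P z - RtoC d * z) <= (1 - d) * Cmod z ^ 2.

(** Both claims are read off on the real points 1 - u. There P is real, so the imaginary part of a1
    vanishes; and the quadratic bound gives P(1 - u) <= d (1 - u) + (1 - d) (1 - u)^2 = 1 - (2 - d)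
    u + O(u^2), so the real part is at least 2 - d > 1. *)
Lemma derivative_at_1 (a1 a2 : C) N r : 0 < r -> 0 <= N -> (forall w, Cmod w < r ->
    Cmod (P (1 + w)%C - (1 + a1 * w + a2 * (w * w))) <= N * Cmod w ^ 3) -> 
  snd a1 = 0 /\ 1 < fst a1.
Proof.
  intros Hr HN H.
  set (r' := Rmin r 1). assert (Hr' : 0 < r') by (apply Rmin_pos; lra).
  assert (Hall : forall u : R, 0 < u < r' ->
    Rabs (snd (P (1 - u)%R) - (snd a1 * - u + snd a2 * u ^ 2)) <= N * u ^ 3 /\
    Rabs (fst (P (1 - u)%R) - (1 + fst a1 * - u + fst a2 * u ^ 2)) <= N * u ^ 3).
  { intros u Hu. assert (Hu1 := Rlt_le_trans _ _ _ (proj2 Hu) (Rmin_l _ _)).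
    specialize (H (RtoC (- u))). rewrite Cmod_R, Rabs_Ropp, Rabs_pos_eq in H by lra.
    specialize (H Hu1). rewrite <- RtoC_plus in H. change (1 + - u) with (1 - u) in H.
    split; [eapply Rle_trans; [|eapply Rle_trans; [apply snd_le_Cmod|exact H]]
           |eapply Rle_trans; [|eapply Rle_trans; [apply fst_le_Cmod|exact H]]];
     right; f_equal; unfold Cminus, Cplus, Copp, Cmult; cbn [fst snd RtoC]; ring. }
  assert (Hpow : forall u, 0 < u < r' -> N * u ^ 3 <= N * u ^ 2).
  { intros u Hu. assert (Hu1 := Rlt_le_trans _ _ _ (proj2 Hu) (Rmin_r _ _)).
    apply Rmult_le_compat_l; auto. assert (0 <= u ^ 2) by (apply pow2_ge_0).
    replace (u ^ 3) with (u ^ 2 * u) by ring. nra. }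
  assert (Hsn : forall u, 0 < u < r' -> Rabs (snd a1 * u) <= (N + Rabs (snd a2)) * u ^ 2).
  { intros u Hu. assert (Hu1 := Rlt_le_trans _ _ _ (proj2 Hu) (Rmin_r _ _)).
    destruct (Hall u Hu) as [X _]. specialize (Hpow u Hu). rewrite hreal in X by lra.
    replace (snd a1 * u) with ((0 - (snd a1 * - u + snd a2 * u ^ 2)) + snd a2 * u ^ 2) by ring.
    eapply Rle_trans; [apply Rabs_triang|]. rewrite (Rabs_mult (snd a2)), (Rabs_pos_eq (u ^ 2)) by apply pow2_ge_0.
    lra. }
  split.
  - apply Rle_antisym.
    + apply (linear_le_quadratic _ (N + Rabs (snd a2)) r'); auto. intros u Hu.
      eapply Rle_trans; [apply Rle_abs|auto].
    + enough (- snd a1 <= 0) by lra.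
      apply (linear_le_quadratic _ (N + Rabs (snd a2)) r'); auto. intros u Hu.
      eapply Rle_trans; [apply Rle_abs|].
      replace (- snd a1 * u) with (- (snd a1 * u)) by ring. rewrite Rabs_Ropp. auto.
  - enough (2 - d - fst a1 <= 0) by lra.
    apply (linear_le_quadratic _ (N + Rabs (fst a2) + 1) r'); auto. intros u Hu.
    assert (Hu1 := Rlt_le_trans _ _ _ (proj2 Hu) (Rmin_r _ _)).
    destruct (Hall u Hu) as [_ X]. specialize (Hpow u Hu).
    assert (Q : Cmod (RtoC (1 - u)) <= 1) by (rewrite Cmod_R, Rabs_pos_eq; lra).
    apply hquad in Q. rewrite Cmod_R, Rabs_pos_eq in Q by lra.
    assert (Q' := Rle_trans _ _ _ (fst_le_Cmod _) Q). 
    change (fst (P (1 - u)%R - d * (1 - u)%R)%C) with (fst (P (1 - u)%R) + - (d * (1 - u) - 0 * 0)) in Q'.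
    apply Rabs_le_between in Q'. apply Rabs_le_between in X.
    assert (fst a2 * u ^ 2 >= - Rabs (fst a2) * u ^ 2).
    { apply Rle_ge, Rmult_le_compat_r; [apply pow2_ge_0|]. assert (Y := Rle_abs (- fst a2)). rewrite Rabs_Ropp in Y. lra. }
    assert (0 <= u ^ 2) by apply pow2_ge_0.
    nra.
Qed.

(* With [g = P z / z], squaring [|g - d| <= 1 - d] bounds [|g|^2] by
   [1 - 2 d (1 - Re g)], while [|1 - g|^2 <= 2 (1 - d) (1 - Re g)]. *)
Lemma circle_gap z : Cmod z = 1 -> d / (1 - d) * Cmod (z - P z) ^ 2 <= - 2 * height (P z).
Proof.
  intros Hz. assert (Q := hquad z). rewrite Hz in Q. specialize (Q (Rle_refl 1)).
  assert (Q2 : Cmod (P z - d * z) ^ 2 <= (1 - d) ^ 2) by (apply pow_incr; split; [apply Cmod_ge_0|lra]).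
  assert (Z2 := Cmod_sqr z). rewrite Hz in Z2.
  rewrite Cmod_sqr in *. unfold height.
  destruct z as [z1 z2]. destruct (P (z1, z2)) as [p1 p2]. simpl in *.
  apply Rmult_le_reg_l with (1 - d); [lra|].
  replace ((1 - d) * (d / (1 - d) * ((z1 + - p1) * ((z1 + - p1) * 1) + (z2 + - p2) * ((z2 + - p2) * 1))))
   with (d * ((z1 + - p1) * ((z1 + - p1) * 1) + (z2 + - p2) * ((z2 + - p2) * 1))) by (field; lra).
  set (q := p1 * p1 + p2 * p2). set (t := p1 * z1 + p2 * z2).
  assert (Hq : q <= 1 - 2 * d + 2 * d * t).
  { unfold q, t. nra. }
  replace ((z1 + - p1) * ((z1 + - p1) * 1) + (z2 + - p2) * ((z2 + - p2) * 1)) with (1 - 2 * t + q)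
    by (unfold t, q; nra).
  replace (-2 * ((p1 * (p1 * 1) + p2 * (p2 * 1) - 1) / 2)) with (1 - q) by (unfold q; field).
  nra.
Qed.

(** The sign of sigma is tested on the unit circle. At distance s from 1 the height of the point is
    0, so that of its image is - sigma s^2 + O(s^3). On the other hand m > 1 forces |z - P z| >= (m
    - 1) s / 2 for small s, and [circle_gap] then puts the height of the image below - c s^2; hence
    sigma >= c > 0. *)
Lemma local_expansion : exists m sigma B K r, 1 < m /\ 0 < sigma /\ 0 <= B /\ 0 <= K /\ 0 < r /\ 
  near1_expansion P m sigma B K r.
Proof.
  destruct (taylor2 P 1 e he hdiff) as [a1 [a2 [N [r0 [Hr0 [HN HT]]]]]]. rewrite h1 in HT.
  destruct (derivative_at_1 a1 a2 N r0 Hr0 HN HT) as [Him Hm].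
  set (m := fst a1) in *.
  assert (Ea1 : a1 = RtoC m) by (unfold m; rewrite (surjective_pairing a1), Him; reflexivity).
  set (sigma := m / 2 + fst a2 - m ^ 2 / 2).
  assert (HA := Cmod_ge_0 a2).
  set (B0 := Cmod a2 + N). set (B := B0 + 2 * Cmod a2).
  set (K := N + 2 * m * B0 + B0 ^ 2 + Cmod a2).
  set (r := Rmin r0 1). assert (Hr : 0 < r) by (apply Rmin_pos; lra).
  assert (HB0 : 0 <= B0) by (unfold B0; lra).
  assert (HK : 0 <= K) by (unfold K; assert (0 <= m * B0) by nra; assert (0 <= B0 ^ 2) by apply pow2_ge_0; lra).
  assert (HB : 0 <= B) by (unfold B; lra).
  assert (Hexp : near1_expansion P m sigma B K r).
  { intros v Hv.
    assert (V1 := Rlt_le_trans _ _ _ Hv (Rmin_l _ _)).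
    assert (V2 := Rlt_le_trans _ _ _ Hv (Rmin_r _ _)).
    assert (V0 := Cmod_ge_0 v).
    specialize (HT v V1).
    set (G := (P (1 + v)%C - 1 - RtoC m * v)%C).
    assert (E1 : Cmod (G - a2 * (v * v)) <= N * Cmod v ^ 3).
    { unfold G. replace (P (1 + v)%C - 1 - m * v - a2 * (v * v))%C with (P (1 + v)%C - (1 + a1 * v + a2 * (v * v)))%C; auto.
      rewrite Ea1. ring. }
    assert (E2 : Cmod G <= B0 * Cmod v ^ 2).
    { replace G with ((G - a2 * (v * v)) + a2 * (v * v))%C by ring.
      eapply Rle_trans; [apply Cmod_triangle|]. rewrite (Cmod_mult a2), Cmod_mult.
      assert (N * Cmod v ^ 3 <= N * Cmod v ^ 2).
      { apply Rmult_le_compat_l; auto. assert (0 <= Cmod v ^ 2) by apply pow2_ge_0. nra. }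
      unfold B0. nra. }
    split.
    - eapply Rle_trans; [apply (expansion_height (P (1 + v)%C) v G a2 m B0 N); auto; try lra|].
      + unfold G. ring.
      + fold K. apply Rplus_le_compat_r, Rmult_le_compat_r; [apply Rabs_pos|].
        apply Rmult_le_compat_r; auto. unfold B. lra.
    - eapply Rle_trans; [apply E2|]. apply Rmult_le_compat_r; [apply pow2_ge_0|]. unfold B; lra. }
  exists m, sigma, B, K, r. repeat (split; auto).
  set (c := d / (1 - d) * ((m - 1) / 2) ^ 2 / 2).
  assert (Hc : 0 < c).
  { unfold c. assert (0 < d / (1 - d)) by (apply Rdiv_lt_0_compat; lra).
    assert (0 < ((m - 1) / 2) ^ 2) by (apply pow_lt; lra). nra. }
  set (r1 := Rmin r ((m - 1) / (2 * (B + 1)))).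
  assert (Hr1 : 0 < r1) by (apply Rmin_pos; auto; apply Rdiv_lt_0_compat; lra).
  enough (c - sigma <= 0) by lra.
  apply (linear_le_quadratic _ K r1); auto. intros s Hs.
  assert (S1 := Rlt_le_trans _ _ _ (proj2 Hs) (Rmin_l _ _)).
  assert (S2 := Rlt_le_trans _ _ _ (proj2 Hs) (Rmin_r _ _)).
  assert (S3 := Rlt_le_trans _ _ _ S1 (Rmin_r _ _)).
  (* The end of a chord of length s from 1: the point 1 + v is on the unit circle exactly when Re v
     = - |v|^2 / 2. *)
  set (v := (- (s ^ 2 / 2), s * sqrt (1 - s ^ 2 / 4)) : C).
  assert (Hv : Cmod v = s).
  { apply Rsqr_inj; [apply Cmod_ge_0|lra|]. unfold Rsqr. 
    replace (Cmod v * Cmod v) with (Cmod v ^ 2) by ring. rewrite Cmod_sqr. unfold v; cbn [fst snd].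
    rewrite Rpow_mult_distr. replace (sqrt (1 - s ^ 2 / 4) ^ 2) with (1 - s ^ 2 / 4) by (symmetry; apply pow2_sqrt; nra).
    field. }
  assert (Hh : height (1 + v) = 0).
  { rewrite height_shift, Hv. unfold v; simpl. field. }
  assert (Hz : Cmod (1 + v) = 1).
  { assert (X := Cmod_sqr (1 + v)). assert (Y := Hh). unfold height in Y. 
    assert (Z := Cmod_ge_0 (1 + v)). nra. }
  destruct (Hexp v) as [X Y]; [lra|]. rewrite Hh, Hv in X. rewrite Hv in Y.
  assert (W := circle_gap _ Hz).
  assert (Hlow : (m - 1) / 2 * s <= Cmod (1 + v - P (1 + v)%C)).
  { assert (Cmod (RtoC (m - 1) * v) <= Cmod (1 + v - P (1 + v)%C) + Cmod (P (1 + v)%C - 1 - m * v)).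
    { rewrite <- (Cmod_opp (1 + v - P (1 + v)%C)), <- (Cmod_opp (P (1 + v)%C - 1 - m * v)).
      replace (RtoC (m - 1) * v)%C with (- (1 + v - P (1 + v)) + - (P (1 + v)%C - 1 - m * v))%C
       by (rewrite RtoC_minus; ring). apply Cmod_triangle. }
    rewrite Cmod_mult, Cmod_R, Rabs_pos_eq, Hv in H by lra.
    assert (s * (2 * (B + 1)) <= m - 1) by (apply Rle_div_r; lra).
    nra. }
  assert (Hc2 : c * s ^ 2 <= - height (P (1 + v)%C)).
  { assert (((m - 1) / 2 * s) ^ 2 <= Cmod (1 + v - P (1 + v)%C) ^ 2).
    { apply pow_incr; split; auto. apply Rmult_le_pos; lra. }
    assert (Hdd : 0 < d / (1 - d)) by (apply Rdiv_lt_0_compat; lra).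
    unfold c. 
    assert (d / (1 - d) * ((m - 1) / 2 * s) ^ 2 <= d / (1 - d) * Cmod (1 + v - P (1 + v)%C) ^ 2)
      by (apply Rmult_le_compat_l; lra).
    replace (d / (1 - d) * ((m - 1) / 2) ^ 2 / 2 * s ^ 2) with (d / (1 - d) * ((m - 1) / 2 * s) ^ 2 / 2) by (field; lra).
    lra. }
  rewrite Rabs_R0 in X. apply Rabs_le_between in X.
  apply Rmult_le_reg_r with s; [lra|]. nra.
Qed.
End Local.

(** * The trapping region and the basin *)

(** The fixed point 1 satisfies the second inequality but never escapes, hence the first
    condition. *)
Definition trap (eps kappa : R) (z : C) : Prop :=
  0 < Cmod (z - 1) /\ height z <= eps * Cmod (z - 1) - kappa * Cmod (z - 1) ^ 2.

(** The linear term eps s becomes m eps s, which is eps s' up to B eps s^2, so it is reproduced; all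
    second-order debts are paid by sigma s^2. They are sigma / 4 for kappa s'^2, sigma / 4 for the
    cubic error, and sigma / 8 twice for B eps s^2, once from the mixed error s |x| and once from
    replacing m s by s'. The two conditions on B delta give (m + 1) / 2 s <= s' <= (m + 1) s. *)
Lemma trap_step P m sigma B K r delta eps kappa z :
  1 < m -> 0 < sigma -> 0 <= B -> 0 <= K -> 0 < kappa -> 0 < eps ->
  near1_expansion P m sigma B K r ->
  delta < r -> B * delta <= 1 -> B * delta <= (m - 1) / 2 -> K * delta <= sigma / 4 ->
  kappa * (m + 1) ^ 2 <= sigma / 4 -> B * eps <= sigma / 8 -> eps <= kappa * delta ->
  trap eps kappa z -> 0 <= height z ->
  Cmod (z - 1) <= delta /\ trap eps kappa (P z) /\ (m + 1) / 2 * Cmod (z - 1) <= Cmod (P z - 1).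
Proof.
  intros Hm Hsig HB HK Hkap Heps Hexp Hdr H1 H2 H3 H4 H5 H6 [Ts Th] Hx.
  set (s := Cmod (z - 1)) in *. set (x := height z) in *.
  (* A non-negative height forces kappa s <= eps <= kappa delta. *)
  assert (Hs : s <= delta) by (apply Rmult_le_reg_l with kappa; auto; apply Rmult_le_reg_r with s; auto; nra).
  destruct (Hexp (z - 1)%C) as [X Y]; [fold s; lra|].
  replace (1 + (z - 1))%C with z in X, Y by ring. fold s x in X, Y.
  set (s' := Cmod (P z - 1)). set (x' := height (P z)) in *.
  assert (S1 : s' <= m * s + B * s ^ 2).
  { unfold s'. replace (P z - 1)%C with ((P z - 1 - m * (z - 1)) + m * (z - 1))%C by ring.
    eapply Rle_trans; [apply Cmod_triangle|]. rewrite Cmod_mult, Cmod_R, Rabs_pos_eq by lra. fold s. lra. }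
  assert (S2 : m * s <= s' + B * s ^ 2).
  { unfold s, s' in *. rewrite <- (Rabs_pos_eq m), <- Cmod_R, <- Cmod_mult by lra.
    replace (m * (z - 1))%C with ((P z - 1) + - (P z - 1 - m * (z - 1)))%C by ring.
    eapply Rle_trans; [apply Cmod_triangle|]. rewrite Cmod_opp. lra. }
  assert (Bs : B * s <= B * delta) by (apply Rmult_le_compat_l; auto).
  assert (Ks : K * s <= K * delta) by (apply Rmult_le_compat_l; auto).
  assert (S3 : (m + 1) / 2 * s <= s') by nra.
  assert (Hs2 : 0 < s ^ 2) by (apply pow_lt; auto).
  split; [exact Hs|split; [split|exact S3]]; [apply Rlt_le_trans with ((m + 1) / 2 * s); [nra|exact S3]|]. fold s' x'.
  rewrite (Rabs_pos_eq x) in X by exact Hx.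
  assert (Hxe : x <= eps * s) by nra.
  apply Rabs_le_between in X.
  assert (X1 : x' <= m * (eps * s - kappa * s ^ 2) - sigma * s ^ 2 + B * eps * s ^ 2 + K * s * s ^ 2).
  { assert (B * s * x <= B * eps * s ^ 2).
    { replace (B * eps * s ^ 2) with (B * s * (eps * s)) by ring. apply Rmult_le_compat_l; auto. apply Rmult_le_pos; lra. }
    assert (m * x <= m * (eps * s - kappa * s ^ 2)) by (apply Rmult_le_compat_l; lra).
    replace (K * s * s ^ 2) with (K * s ^ 3) by ring. lra. }
  assert (S4 : s' ^ 2 <= (m + 1) ^ 2 * s ^ 2).
  { rewrite <- Rpow_mult_distr. apply pow_incr; split; [apply Cmod_ge_0|]. nra. }
  assert (S5 : eps * (m * s - B * s ^ 2) <= eps * s') by (apply Rmult_le_compat_l; lra).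
  assert (S6 : kappa * s' ^ 2 <= sigma / 4 * s ^ 2).
  { eapply Rle_trans; [apply Rmult_le_compat_l; [lra|apply S4]|]. rewrite <- Rmult_assoc.
    apply Rmult_le_compat_r; lra. }
  assert (S7 : K * s * s ^ 2 <= sigma / 4 * s ^ 2) by (apply Rmult_le_compat_r; lra).
  assert (S8 : B * eps * s ^ 2 <= sigma / 8 * s ^ 2) by (apply Rmult_le_compat_r; lra).
  assert (S9 : 0 <= m * kappa * s ^ 2) by (repeat apply Rmult_le_pos; lra).
  nra.
Qed.

(** As long as the height is non-negative, the distance to 1 is at most delta and yet grows by the
    factor (m + 1) / 2 > 1; this cannot last. The bound on the earlier iterates is what later keeps
    the orbit inside the domain. *)
Lemma trap_escape P m r delta eps kappa : 1 < m -> delta < r ->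
  (forall z, trap eps kappa z -> 0 <= height z ->
    Cmod (z - 1) <= delta /\ trap eps kappa (P z) /\ (m + 1) / 2 * Cmod (z - 1) <= Cmod (P z - 1)) ->
  forall z, trap eps kappa z ->
  exists k, Cmod (Nat.iter k P z) < 1 /\ forall j, (j < k)%nat -> Cmod (Nat.iter j P z - 1) < r.
Proof.
  intros Hm Hdr Hstep.
  assert (H : forall n z, trap eps kappa z -> delta < ((m + 1) / 2) ^ n * Cmod (z - 1) ->
    exists k, Cmod (Nat.iter k P z) < 1 /\ forall j, (j < k)%nat -> Cmod (Nat.iter j P z - 1) < r).
  { induction n; intros z Hz Hn.
    - exists O; split; [|intros; lia]. apply height_neg. apply Rnot_le_lt; intros Hh.
      destruct (Hstep z Hz Hh) as [H _]. simpl in Hn. lra.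
    - destruct (Rlt_le_dec (height z) 0) as [Hh|Hh].
      { exists O; split; [|intros; lia]. now apply height_neg. }
      destruct (Hstep z Hz Hh) as [H1 [H2 H3]].
      destruct (IHn (P z) H2) as [k [Hk1 Hk2]].
      { eapply Rlt_le_trans; [apply Hn|]. simpl. rewrite (Rmult_comm ((m + 1) / 2)), Rmult_assoc.
        apply Rmult_le_compat_l; auto. apply pow_le; lra. }
      exists (S k); split; [now rewrite Nat.iter_succ_r|].
      intros [|j] Hj; [simpl; lra|]. rewrite Nat.iter_succ_r. apply Hk2. lia. }
  intros z Hz.
  (* The added 1 turns the non-strict bound obtained here into a strict one. *)
  destruct (Pow_x_infinity ((m + 1) / 2)) with (b := delta / Cmod (z - 1) + 1) as [n Hn].
  { rewrite Rabs_pos_eq; lra. }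
  apply (H n); auto. destruct Hz as [Hz _].
  specialize (Hn n (le_n n)). rewrite Rabs_pos_eq in Hn by (apply pow_le; lra).
  apply Rlt_div_l; auto. lra.
Qed.

Section Basin.
Variables (D : C -> Prop) (P : C -> C) (d : R).
Hypothesis hd : 0 < d < 1.
Hypothesis hD : forall z : C, Cmod z <= 1 -> D z.
Hypothesis hquad : forall z, Cmod z <= 1 -> Cmod (P z - RtoC d * z) <= (1 - d) * Cmod z ^ 2.

(** Since |P y| <= (d + (1 - d) |y|) |y|, the map contracts the disc of radius |z| towards 0 with
    the fixed factor [q] < 1. *)
Lemma basin0_unit_disc z : Cmod z < 1 -> basin0 D P z.
Proof.
  intros Hz. assert (H0 := Cmod_ge_0 z).
  set (q := d + (1 - d) * Cmod z). assert (Hq : 0 <= q < 1) by (unfold q; split; nra).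
  assert (Hstep : forall y, Cmod y <= Cmod z -> Cmod (P y) <= q * Cmod y).
  { intros y Hy. assert (Y := Cmod_ge_0 y).
    replace (P y) with (P y - d * y + d * y)%C by ring. eapply Rle_trans; [apply Cmod_triangle|].
    rewrite Cmod_mult, Cmod_R, Rabs_pos_eq by lra. assert (X := hquad y). unfold q.
    assert (Cmod y ^ 2 <= Cmod z * Cmod y) by nra.
    specialize (X ltac:(lra)). nra. }
  assert (Hit : forall t, Cmod (Nat.iter t P z) <= q ^ t * Cmod z).
  { induction t; [simpl; lra|]. 
    assert (q ^ t <= 1) by (rewrite <- (pow1 t); apply pow_incr; lra).
    change (Nat.iter (S t) P z) with (P (Nat.iter t P z)).
    eapply Rle_trans; [apply Hstep; nra|]. simpl. rewrite Rmult_assoc. apply Rmult_le_compat_l; lra. }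
  split.
  - intros t. apply hD. eapply Rle_trans; [apply Hit|].
    assert (q ^ t <= 1) by (rewrite <- (pow1 t); apply pow_incr; lra). 
    assert (0 <= q ^ t) by (apply pow_le; lra). nra.
  - intros A HA. apply locally_Cmod in HA. destruct HA as [e [He HA]].
    destruct (pow_lt_1_zero q) with (y := e) as [N HN]; [rewrite Rabs_pos_eq; lra|auto|].
    exists N. intros n Hn. apply HA. replace (Nat.iter n P z - 0)%C with (Nat.iter n P z) by ring.
    specialize (HN n Hn). rewrite Rabs_pos_eq in HN by (apply pow_le; lra).
    eapply Rle_lt_trans; [apply Hit|]. assert (0 <= q ^ n) by (apply pow_le; lra). nra.
Qed.

Lemma basin0_preimage z : D z -> basin0 D P (P z) -> basin0 D P z.
Proof.
  intros Hz [H1 H2]. split.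
  - intros [|t]; [exact Hz|]. rewrite Nat.iter_succ_r. apply H1.
  - intros A HA. destruct (H2 A HA) as [N HN]. exists (S N). intros [|n] Hn; [lia|].
    rewrite Nat.iter_succ_r. apply HN. lia.
Qed.

Lemma basin0_iter k z : basin0 D P (Nat.iter k P z) -> (forall j, (j < k)%nat -> D (Nat.iter j P z)) -> basin0 D P z.
Proof.
  revert z; induction k; intros z H Hj; [exact H|].
  apply basin0_preimage; [apply (Hj O); lia|]. apply IHk.
  - rewrite <- Nat.iter_succ_r. exact H.
  - intros j Hjk. rewrite <- Nat.iter_succ_r. apply Hj. lia.
Qed.
End Basin.

(** * Connectedness along Lipschitz paths *)

Lemma connected_path (g : R -> C) (L : R) : 0 <= L -> 
  (forall s t, Cmod (g s - g t) <= L * Rabs (s - t)) ->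
  connected (T := C_UniformSpace) (fun z => exists t, 0 <= t <= 1 /\ z = g t).
Proof.
  intros HL Hg U V HU HV Hcov [x [[t1 [Ht1 ->]] HxU]] [y [[t2 [Ht2 ->]] HyV]].
  apply NNPP. intros Hno.
  assert (Hcont : forall W : C -> Prop, open (T := C_UniformSpace) W -> forall t, W (g t) ->
    exists e, 0 < e /\ forall s, Rabs (s - t) < e -> W (g s)).
  { intros W HW t Ht. destruct (proj1 (locally_Cmod _ _) (HW _ Ht)) as [e [He H]].
    exists (e / (L + 1)). split; [apply Rdiv_lt_0_compat; lra|]. intros s Hs. apply H.
    eapply Rle_lt_trans; [apply Hg|]. apply Rlt_div_r in Hs; [|lra]. 
    assert (X := Rabs_pos (s - t)). nra. }
  assert (Hdis : forall t, 0 <= t <= 1 -> U (g t) -> V (g t) -> False).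
  { intros t Ht H1 H2. apply Hno. exists (g t). split; auto. exists t; auto. }
  assert (Hor : forall t, 0 <= t <= 1 -> U (g t) \/ V (g t)).
  { intros t Ht. apply Hcov. exists t; auto. }
  (* Stated for arbitrary [U] and [V], so that the roles can be exchanged according to the order of
     [t1] and [t2]. The supremum of the parameters in [U] can lie in neither open set. *)
  assert (Hmain : forall (U V : C -> Prop) a b, 0 <= a -> a <= b -> b <= 1 ->
     open (T := C_UniformSpace) U -> open (T := C_UniformSpace) V -> U (g a) -> V (g b) ->
     (forall t, 0 <= t <= 1 -> U (g t) -> V (g t) -> False) ->
     (forall t, 0 <= t <= 1 -> U (g t) \/ V (g t)) -> False).
  { clear - Hcont. intros U V a b Ha Hab Hb HU HV HUa HVb Hdis Hor.
    destruct (completeness (fun t => a <= t <= b /\ U (g t))) as [c [Hc1 Hc2]].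
    - exists b. intros t [Ht _]; lra.
    - exists a. split; auto; lra.
    - assert (Hac : a <= c) by (apply Hc1; split; auto; lra).
      assert (Hcb : c <= b) by (apply Hc2; intros t [Ht _]; lra).
      destruct (Hor c) as [Hc|Hc]; [lra| |].
      + destruct (Hcont U HU c Hc) as [e [He H]].
        assert (Hlt : c < b).
        { destruct (Rle_lt_or_eq_dec c b Hcb) as [|E]; auto. subst c. exfalso. apply (Hdis b); auto; lra. }
        set (t := Rmin b (c + e / 2)).
        assert (T1 : t <= b) by apply Rmin_l. assert (T2 : t <= c + e / 2) by apply Rmin_r.
        assert (T3 : c < t) by (apply Rmin_glb_lt; lra).
        assert (t <= c); [|lra]. apply Hc1. split; [lra|]. apply H. rewrite Rabs_pos_eq; lra.
      + destruct (Hcont V HV c Hc) as [e [He H]].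
        assert (c <= c - e / 2); [|lra]. apply Hc2. intros t [Ht HUt].
        apply Rnot_lt_le; intros Hlt. assert (t <= c) by (apply Hc1; auto).
        apply (Hdis t); auto; [lra|]. apply H. apply Rabs_def1; lra. }
  destruct (Rle_dec t1 t2).
  - apply (Hmain U V t1 t2); auto; lra.
  - apply (Hmain V U t2 t1); auto; try lra.
    + intros t Ht A1 A2. apply (Hdis t); auto.
    + intros t Ht. destruct (Hor t Ht); auto.
Qed.

(** Two connected sets sharing y have a connected union: y falls into one of the two open sets, and
    a witness for the other lies in one of the pieces, which then meets both. *)
Lemma connected_component_trans {T : UniformSpace} (A : T -> Prop) x y z :
  connected_component A x y -> connected_component A y z -> connected_component A x z.
Proof.
  intros [S1 [C1 [A1 [X1 Y1]]]] [S2 [C2 [A2 [Y2 Z2]]]].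
  exists (fun t => S1 t \/ S2 t). split; [|split; [intros t [H|H]; auto|auto]].
  intros U V HU HV Hcov [a [Ha HaU]] [b [Hb HbV]].
  assert (W1 : (exists u, S1 u /\ U u) -> (exists u, S1 u /\ V u) -> exists t, (S1 t \/ S2 t) /\ U t /\ V t).
  { intros E1 E2. destruct (C1 U V HU HV) as [t [Ht1 Ht2]]; auto. exists t; auto. }
  assert (W2 : (exists u, S2 u /\ U u) -> (exists u, S2 u /\ V u) -> exists t, (S1 t \/ S2 t) /\ U t /\ V t).
  { intros E1 E2. destruct (C2 U V HU HV) as [t [Ht1 Ht2]]; auto. exists t; auto. }
  destruct (Hcov y (or_introl Y1)) as [Hy|Hy].
  - destruct Hb as [Hb|Hb]; [apply W1|apply W2]; (exists y; now split) || (exists b; now split).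
  - destruct Ha as [Ha|Ha]; [apply W1|apply W2]; (exists a; now split) || (exists y; now split).
Qed.

Lemma connected_component_path (A : C -> Prop) (g : R -> C) L : 0 <= L ->
  (forall s t, Cmod (g s - g t) <= L * Rabs (s - t)) -> (forall t, 0 <= t <= 1 -> A (g t)) ->
  connected_component (T := C_UniformSpace) A (g 0) (g 1).
Proof.
  intros HL Hg HA. exists (fun z => exists t, 0 <= t <= 1 /\ z = g t).
  split; [now apply connected_path with L|]. split; [intros z [t [Ht ->]]; auto|].
  split; [exists 0|exists 1]; split; auto; lra.
Qed.

(** * Sectors at 1 in polar coordinates *)

(** The factor 2 comes from treating cosine and sine separately by the mean value theorem; any
    Lipschitz constant serves to make arcs admissible paths. *)
Lemma Cmod_cis_sub a b : Cmod (cis a - cis b) <= 2 * Rabs (a - b).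
Proof.
  assert (Hl : forall (f f' : R -> R), (forall x, derivable_pt_lim f x (f' x)) -> (forall x, Rabs (f' x) <= 1) ->
     Rabs (f a - f b) <= Rabs (a - b)).
  { intros f f' Hf Hb.
    destruct (MVT_gen f b a f') as [c [_ Hc]].
    - intros x _. apply is_derive_Reals, Hf.
    - intros x _. apply derivable_continuous_pt. exists (f' x). apply Hf.
    - rewrite Hc, Rabs_mult. assert (X := Hb c). assert (Y := Rabs_pos (a - b)). nra. }
  eapply Rle_trans; [apply (Cmod_le_1 (cos a - cos b) (sin a - sin b))|].
  assert (H1 := Hl cos (fun x => - sin x) derivable_pt_lim_cos).
  assert (H2 := Hl sin cos derivable_pt_lim_sin).
  enough (Rabs (cos a - cos b) <= Rabs (a - b) /\ Rabs (sin a - sin b) <= Rabs (a - b)) by lra.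
  split; [apply H1|apply H2]; intros x; apply Rabs_le.
  - assert (X := SIN_bound x); lra.
  - assert (X := COS_bound x); lra.
Qed.

(** Beyond the right angle cos phi = - sin (|phi| - pi / 2), and sin x < x for x > 0. *)
Lemma cos_ge_opp phi nu : Rabs phi < PI / 2 + nu -> 0 < nu <= PI / 2 -> - nu <= cos phi.
Proof.
  intros H Hnu. assert (HP := PI_RGT_0).
  assert (E : cos phi = - sin (Rabs phi - PI / 2)).
  { replace (cos phi) with (cos (Rabs phi)).
    - rewrite <- sin_neg, <- cos_shift. f_equal. ring.
    - unfold Rabs. destruct (Rcase_abs phi); [apply cos_neg|reflexivity]. }
  rewrite E. assert (H0 := Rabs_pos phi).
  destruct (Rle_lt_dec (Rabs phi - PI / 2) 0) as [L|L].
  - assert (sin (Rabs phi - PI / 2) <= 0); [|lra].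
    rewrite <- (Ropp_involutive (Rabs phi - PI / 2)), sin_neg.
    assert (0 <= sin (- (Rabs phi - PI / 2))) by (apply sin_ge_0; lra). lra.
  - assert (X := sin_lt_x _ L). lra.
Qed.

Lemma Cmod_cis phi : Cmod (cis phi) = 1.
Proof.
  unfold Cmod, cis. cbn [fst snd].
  replace (cos phi ^ 2 + sin phi ^ 2) with 1; [apply sqrt_1|].
  rewrite <- (sin2_cos2 phi). unfold Rsqr. ring.
Qed.

Lemma polar_dist (r phi : R) : 0 < r -> Cmod (1 - r * cis phi - 1) = r.
Proof.
  intros Hr. replace (1 - r * cis phi - 1)%C with (- (r * cis phi))%C by ring.
  rewrite Cmod_opp, Cmod_mult, Cmod_cis, Cmod_R, Rabs_pos_eq; lra.
Qed.

Lemma polar_height (r phi : R) : height (1 - r * cis phi) = - r * cos phi + r ^ 2 / 2.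
Proof.
  replace (1 - r * cis phi)%C with (1 + - (r * cis phi))%C by ring.
  rewrite height_shift, Cmod_opp, Cmod_mult, Cmod_cis, Cmod_R, Rmult_1_r, pow2_abs.
  simpl. ring.
Qed.

Theorem corollary2p7 (p : nat -> R) (D : C -> Prop) (P : C -> C) (d : R)
  (hp : is_pgf p)
  (hanalytic : pgf_analytic_near p (RtoC 1))
  (hP : pgf_on_domain p D P)
  (hP0 : P (RtoC 0) = RtoC 0)
  (hd : C_derive P (RtoC 0) = RtoC d)
  (hd01 : 0 < d < 1) :
  Rbar_lt (Finite (PI / 2)) (critical_angle D P).
Proof.
  destruct hP as [_ [hD [_ hext]]].
  assert (hquad := pgf_quadratic p D P d hp hD hext hP0 hd).
  assert (hreal := pgf_real p D P hD hext).
  assert (h1 := pgf_at_1 p D P hp hD hext).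
  destruct hext as [[hopen hdiff] _].
  destruct (proj1 (locally_Cmod 1 D)) as [e [He HeD]].
  { apply hopen, hD. rewrite Cmod_1; lra. }
  destruct (local_expansion P d e hd01 He) as [m [sigma [B [K [r0 [Hm [Hsig [HB [HK [Hr0 Hexp0]]]]]]]]]]; auto.
  { intros z Hz. apply hdiff. auto. }
  (* The bound by [e] puts every point within [r] of 1 in [D], so an orbit cannot leave [D] before
     it reaches the disc. *)
  set (r := Rmin r0 e). assert (Hr : 0 < r) by (apply Rmin_pos; auto).
  assert (Hexp : near1_expansion P m sigma B K r).
  { intros v Hv. apply Hexp0. eapply Rlt_le_trans; [apply Hv|apply Rmin_l]. }
  set (kappa := sigma / (4 * (m + 1) ^ 2)).
  assert (Hm2 : 0 < (m + 1) ^ 2) by (apply pow_lt; lra).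
  assert (Hkap : 0 < kappa) by (apply Rdiv_lt_0_compat; lra).
  (* The three upper bounds that [trap_step] sets on B delta and K delta, met together by delta (B +
     K + 1) <= c. *)
  set (c := Rmin 1 (Rmin ((m - 1) / 2) (sigma / 4))).
  assert (Hc : 0 < c) by (repeat apply Rmin_pos; lra).
  assert (Hc1 : c <= 1) by apply Rmin_l.
  assert (Hc2 : c <= (m - 1) / 2) by (eapply Rle_trans; [apply Rmin_r|apply Rmin_l]).
  assert (Hc3 : c <= sigma / 4) by (eapply Rle_trans; [apply Rmin_r|apply Rmin_r]).
  set (delta := Rmin (r / 2) (c / (B + K + 1))).
  assert (Hdel : 0 < delta) by (apply Rmin_pos; [lra|apply Rdiv_lt_0_compat; lra]).
  assert (Hdel1 : delta <= r / 2) by apply Rmin_l.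
  assert (Hdel2 : delta * (B + K + 1) <= c) by (apply Rle_div_r; [lra|apply Rmin_r]).
  set (eps := Rmin (sigma / (8 * (B + 1))) (kappa * delta)).
  assert (Heps : 0 < eps).
  { apply Rmin_pos; [apply Rdiv_lt_0_compat; lra|now apply Rmult_lt_0_compat]. }
  assert (Heps1 : eps * (8 * (B + 1)) <= sigma) by (apply Rle_div_r; [lra|apply Rmin_l]).
  assert (Heps2 : eps <= kappa * delta) by apply Rmin_r.
  assert (Htrap : forall z, trap eps kappa z -> basin0 D P z).
  { intros z Hz.
    destruct (trap_escape P m r delta eps kappa Hm) with (z := z) as [k [Hk1 Hk2]]; auto; [lra| |].
    - intros y Hy Hh. apply (trap_step P m sigma B K r delta eps kappa); auto; try lra; try nra.
      right. unfold kappa. field. nra.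
    - apply basin0_iter with k.
      + now apply basin0_unit_disc with d.
      + intros j Hj. apply HeD. eapply Rlt_le_trans; [apply Hk2; auto|apply Rmin_r]. }
  assert (HPI := PI_RGT_0).
  (* The angle gained beyond pi / 2. At distance s from 1 it costs at most s eps / 4 in height, and
     the radius [s0] below keeps s^2 / 2 + kappa s^2 under s eps / 2, so the sector lies in the
     trap. The cap keeps pi / 2 + nu within pi, as the critical angle requires. *)
  set (nu := Rmin (eps / 4) (PI / 2)).
  assert (Hnu : 0 < nu <= PI / 2) by (split; [apply Rmin_pos; lra|apply Rmin_r]).
  assert (Hnu1 : nu <= eps / 4) by apply Rmin_l.
  set (s0 := Rmin 1 (eps / (2 * (1 + kappa)))).
  assert (Hs0 : 0 < s0) by (apply Rmin_pos; [lra|apply Rdiv_lt_0_compat; lra]).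
  assert (Hsec : forall phi s, - (PI / 2 + nu) < phi < PI / 2 + nu -> 0 < s < s0 -> basin0 D P (1 - s * cis phi)%C).
  { intros phi s Hphi Hs. apply Htrap. unfold trap. rewrite polar_dist, polar_height by lra.
    split; [lra|].
    assert (s * (2 * (1 + kappa)) <= eps).
    { apply Rle_div_r; [lra|]. apply Rlt_le. eapply Rlt_le_trans; [apply Hs|apply Rmin_r]. }
    assert (Hcos := cos_ge_opp phi nu (Rabs_def1 _ _ (proj2 Hphi) (proj1 Hphi)) Hnu).
    assert (- s * cos phi <= s * (eps / 4)) by nra.
    nra. }
  apply Rbar_lt_le_trans with (Finite (PI / 2 + nu)); [simpl; lra|].
  apply (proj1 (Lub_Rbar_correct _)). split; [lra|].
  exists s0. split; [auto|]. intros phi s Hphi Hs.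
  assert (Hs1 : s < 1) by (eapply Rlt_le_trans; [apply Hs|apply Rmin_l]).
  (* A point of the sector is joined to 0 by the arc of radius s about 1 back to the real axis,
     inside the sector, followed by a real segment inside the unit disc. *)
  apply connected_component_trans with (RtoC (1 - s)).
  - replace (RtoC 0) with (RtoC (0 * (1 - s))) by (f_equal; ring).
    replace (RtoC (1 - s)) with (RtoC (1 * (1 - s))) by (f_equal; ring).
    apply (connected_component_path _ (fun t => RtoC (t * (1 - s))) 1); [lra| |].
    + intros a b. rewrite <- RtoC_minus, Cmod_R, <- Rmult_minus_distr_r, Rabs_mult, (Rabs_pos_eq (1 - s)) by lra.
      assert (X := Rabs_pos (a - b)). nra.
    + intros t Ht. apply basin0_unit_disc with d; auto. rewrite Cmod_R, Rabs_pos_eq; nra.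
  - replace (RtoC (1 - s)) with (1 - s * cis (0 * phi))%C.
    2:{ rewrite Rmult_0_l. unfold cis. rewrite cos_0, sin_0. rewrite RtoC_minus.
        change ((1, 0) : C) with (RtoC 1). ring. }
    replace (cis phi) with (cis (1 * phi)) by (f_equal; ring).
    apply (connected_component_path _ (fun t => 1 - s * cis (t * phi))%C (2 * Rabs phi)).
    + assert (X := Rabs_pos phi); lra.
    + intros a b.
      replace (1 - s * cis (a * phi) - (1 - s * cis (b * phi)))%C with (- (s * (cis (a * phi) - cis (b * phi))))%C by ring.
      rewrite Cmod_opp, Cmod_mult, Cmod_R, Rabs_pos_eq by lra.
      assert (X := Cmod_cis_sub (a * phi) (b * phi)). rewrite <- Rmult_minus_distr_r, Rabs_mult in X.
      assert (Y := Cmod_ge_0 (cis (a * phi) - cis (b * phi))). nra.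
    + intros t Ht. apply Hsec; auto. nra.
Qed.
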